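(* Let $1\le p,q<\infty$ with $p\ne q$ and $p,q\neq2$, let $n\ge1$, and let $X=\ell^p(A)\oplus\ell^q(B)$ with $A,B$ disjoint copies of $\mathbb N$. Suppose the sum norm on $X$ is absolute, normalized, and strictly monotone. Then $$\operatorname{Isom}(X)=\operatorname{Isom}(\ell^p(A))\times\operatorname{Isom}(\ell^q(B)),$$ hence every stratum $$\Sigma_{\alpha,\gamma}=\{V\in\mathrm{Gr}_n(X):\dim(V\cap\ell^p(A))=\alpha,\ \dim(V\cap\ell^q(B))=\gamma\}$$ is invariant under the full isometry group: the profile is a complete isometric invariant of coarse position (that is, it is $\operatorname{Isom}(X)$-invariant and determines the stratum of $V$), on a space $\mathrm{Gr}_n(X)$ that is nevertheless a single $\mathrm{GL}(X)$-orbit.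
   Context: Scalars are complex. $\operatorname{Isom}(Y)$ is the group of surjective linear isometries of $Y$; $\mathrm{GL}(X)$ is the group of bounded invertible linear operators on $X$. The sum norm has the form $\|(x,y)\|=N(\|x\|_p,\|y\|_q)$ where $N$ is a norm on $\mathbb R^2$ with $N(s,t)=N(|s|,|t|)$ (absolute), $N(1,0)=N(0,1)=1$ (normalized), and $N(s,t)<N(s',t')$ whenever $0\le s\le s'$, $0\le t\le t'$ and $(s,t)\neq(s',t')$ (strictly monotone). $\mathrm{Gr}_n(X)$ is the set of $n$-dimensional subspaces of $X$. For $V\in\mathrm{Gr}_n(X)$ with basis $v_1,\dots,v_n$, put $p_I=\det(v_r(i_s))_{r,s}$ for $n$-element subsets $I=\{i_1<\dots<i_n\}\subset A\sqcup B$; the profile of $V$ is $\operatorname{prof}(V)=\{(a,b): a+b=n,\ p_I\ne0\text{ for some } I\text{ with }|I\cap A|=a,\ |I\cap B|=b\}$. *)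

(* Defs.v *)
From HB Require Import structures.
From mathcomp Require Import all_boot all_order all_algebra.
From mathcomp Require Import complex.
From mathcomp Require Import all_classical all_reals all_analysis.

Set Implicit Arguments.
Unset Strict Implicit.
Unset Printing Implicit Defensive.

Import Order.TTheory GRing.Theory Num.Theory.
Import numFieldNormedType.Exports.
Import Normc.

Local Open Scope classical_set_scope.
Local Open Scope ring_scope.
Local Open Scope complex_scope.

Section lp_norm.
Context {R : realType}.
Implicit Types (p : R) (x y : nat -> R[i]).

Definition lp_norm p x : \bar R := 'N[counting]_(p%:E)[EFin \o (@normc R \o x)].

Lemma normc_ge0 (z : R[i]) : 0 <= normc z.
Proof. by case: z => a b; exact: sqrtr_ge0. Qed.

Lemma lp_norm_ge0 p x : (0 <= lp_norm p x)%E.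
Proof. exact: Lnorm_ge0. Qed.

Lemma lp_norm0 p : 1 <= p -> lp_norm p 0 = 0%E.
Proof.
move=> p1; rewrite /lp_norm (eq_Lnorm _ _ (g := cst 0%E)).
  by rewrite Lnorm0// eqe gt_eqF// (lt_le_trans ltr01).
by move=> k; congr EFin; exact: normc0.
Qed.

Lemma lp_normD p x y : 1 <= p ->
  (lp_norm p (x + y)%R <= lp_norm p x + lp_norm p y)%E.
Proof.
move=> p1; have p0 : 0 < p := lt_le_trans ltr01 p1.
have xy : ('N[@counting nat R]_(p%:E)[EFin \o ((@normc R \o x) \+ (@normc R \o y))%R] <=
           lp_norm p x + lp_norm p y)%E.
  exact: minkowski_EFin.
apply: le_trans xy; rewrite /lp_norm !Lnorm_counting//.
apply: gt0_ler_poweR; rewrite ?invr_ge0 ?(ltW p0)//.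
- by rewrite in_itv/= leey andbT nneseries_ge0// => k _ _; exact: poweR_ge0.
- by rewrite in_itv/= leey andbT nneseries_ge0// => k _ _; exact: poweR_ge0.
apply: lee_nneseries => [k _ _|k _]; first exact: poweR_ge0.
rewrite /= lee_fin ge0_ler_powR ?nnegrE ?normr_ge0 ?(ltW p0)//.
by rewrite !ger0_norm ?addr_ge0 ?normc_ge0//; exact: le_normcD.
Qed.

Lemma lp_normZ p (a : R[i]) x : 1 <= p ->
  (lp_norm p (a *: x)%R = (normc a)%:E * lp_norm p x)%E.
Proof.
move=> p1; have p0 : 0 < p := lt_le_trans ltr01 p1.
rewrite /lp_norm !Lnorm_counting//.
have -> : (\sum_(k <oo) (`|(EFin \o (@normc R \o (a *: x)%R)) k| `^ p) =
    (normc a `^ p)%:E * \sum_(k <oo) (`|(EFin \o (@normc R \o x)) k| `^ p))%E.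
  rewrite -nneseriesZl ?lee_fin ?powR_ge0//; last first.
    by move=> k _; exact: poweR_ge0.
  apply: eq_eseriesr => k _ /=.
  rewrite -EFinM; congr EFin.
  by rewrite normcM normrM powRM// ger0_norm ?normc_ge0.
rewrite poweRM ?lee_fin ?powR_ge0//; last first.
  by apply: nneseries_ge0 => k _ _; exact: poweR_ge0.
by rewrite poweR_EFin -powRrM mulfV ?gt_eqF// powRr1// normc_ge0.
Qed.

Lemma lp_norm_eq0 p x : 1 <= p -> lp_norm p x = 0%E -> x = 0.
Proof.
move=> p1; have p0 : 0 < p := lt_le_trans ltr01 p1.
rewrite /lp_norm Lnorm_counting//.
have ge0 k : (0 <= `|(EFin \o (@normc R \o x)) k| `^ p)%E by exact: poweR_ge0.
move/poweR_eq0_eq0 => /(_ (nneseries_ge0 (fun k _ _ => ge0 k))) s0.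
apply/funext => k; apply: eq0_normc.
have : (`|(EFin \o (@normc R \o x)) k| `^ p)%E = 0%E.
  apply/eqP; rewrite eq_le ge0 andbT -[leRHS]s0.
  apply: le_trans (nneseries_lim_ge k.+1 (fun k _ _ => ge0 k)).
  by rewrite big_nat_recr//= leeDr// sume_ge0.
by move/poweR_eq0_eq0 => /(_ (abse_ge0 _)) /eqP; rewrite abse_eq0 => /eqP[].
Qed.

End lp_norm.

Section lp_space.
Context {R : realType}.

Definition lp_pred (p : R) : {pred nat -> R[i]} :=
  fun x => (lp_norm p x < +oo)%E.

Record lp (p : R) (p1 : 1 <= p) := Lp {
  lp_val :> nat -> R[i];
  lp_valP : lp_val \in lp_pred p }.

Variables (p : R) (p1 : 1 <= p).

Lemma lp_submod_closed : submod_closed (lp_pred p).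
Proof.
split=> [|a x y xp yp]; first by rewrite unfold_in lp_norm0.
rewrite unfold_in (le_lt_trans (lp_normD _ _ p1))// lp_normZ//.
by rewrite lte_add_pinfty// lte_mul_pinfty// lee_fin normc_ge0.
Qed.

HB.instance Definition _ :=
  GRing.isSubmodClosed.Build _ _ (lp_pred p) lp_submod_closed.

HB.instance Definition _ := [isSub for @lp_val p p1].
HB.instance Definition _ := [Choice of lp p1 by <:].
HB.instance Definition _ := [SubChoice_isSubLmodule of lp p1 by <:].

Lemma lpD (x y : lp p1) k : (x + y) k = x k + y k.
Proof. by []. Qed.

Lemma lpZ a (x : lp p1) k : (a *: x) k = a * x k.
Proof. by []. Qed.

Definition lp_nrm (x : lp p1) : R[i] := (fine (lp_norm p x))%:C.

Lemma lp_nrm_fin (x : lp p1) : lp_norm p x \is a fin_num.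
Proof. by rewrite ge0_fin_numE ?lp_norm_ge0//; exact: lp_valP. Qed.

Lemma lp_nrmD (x y : lp p1) : lp_nrm (x + y) <= lp_nrm x + lp_nrm y.
Proof.
rewrite /lp_nrm -rmorphD/= lecR -fineD ?lp_nrm_fin//.
rewrite fine_le ?fin_numD ?lp_nrm_fin//; first exact: (lp_nrm_fin (x + y)).
exact: lp_normD.
Qed.

Lemma lp_nrmZ (a : R[i]) (x : lp p1) : lp_nrm (a *: x) = `|a| * lp_nrm x.
Proof.
by rewrite /lp_nrm [X in fine X]lp_normZ// fineM ?lp_nrm_fin// rmorphM.
Qed.

Lemma lp_nrm_eq0 (x : lp p1) : lp_nrm x = 0 -> x = 0.
Proof.
move=> /complexI /eqP; rewrite fine_eq0 ?lp_nrm_fin// => /eqP x0.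
by apply: val_inj; exact: lp_norm_eq0 x0.
Qed.

HB.instance Definition _ :=
  Lmodule_isNormed.Build R[i] (lp p1) lp_nrmD lp_nrmZ lp_nrm_eq0.

Lemma lp_normrE (x : lp p1) : `|x| = (fine (lp_norm p x))%:C.
Proof. by []. Qed.

End lp_space.

Section sum_norm.
Context {R : realType}.

Record sum_norm := SumNorm {
  sumN :> R -> R -> R;
  sumND : forall s t s' t', sumN (s + s') (t + t') <= sumN s t + sumN s' t';
  sumNZ : forall c s t, sumN (c * s) (c * t) = `|c| * sumN s t;
  sumN_eq0 : forall s t, sumN s t = 0 -> s = 0 /\ t = 0;
  sumN_abs : forall s t, sumN s t = sumN `|s| `|t|;
  sumN10 : sumN 1 0 = 1;
  sumN01 : sumN 0 1 = 1;
  sumN_mono : forall s t s' t', 0 <= s <= s' -> 0 <= t <= t' ->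
    (s, t) <> (s', t') -> sumN s t < sumN s' t' }.

Lemma sumN_le (N : sum_norm) s t s' t' :
  0 <= s <= s' -> 0 <= t <= t' -> N s t <= N s' t'.
Proof.
move=> ss' tt'; have [[<- <-]//|st] := pselect ((s, t) = (s', t')).
exact/ltW/sumN_mono.
Qed.

(* The carrier is the product, but not its instances: [U * V] is canonically
   normed by the max norm. *)
Definition dsum (N : sum_norm) (U V : normedModType R[i]) : Type := (U * V)%type.

Variables (N : sum_norm) (U V : normedModType R[i]).

HB.instance Definition _ := GRing.Lmodule.copy (dsum N U V) (U * V)%type.

Lemma dsumD1 (x y : dsum N U V) : (x + y).1 = x.1 + y.1.
Proof. by []. Qed.

Lemma dsumD2 (x y : dsum N U V) : (x + y).2 = x.2 + y.2.
Proof. by []. Qed.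

Lemma dsumZ1 a (x : dsum N U V) : (a *: x).1 = a *: x.1.
Proof. by []. Qed.

Lemma dsumZ2 a (x : dsum N U V) : (a *: x).2 = a *: x.2.
Proof. by []. Qed.

(* Norms over R[i] take their values in the nonnegative reals of R[i], hence
   the [Re] and [%:C]. *)
Definition dsum_nrm (z : dsum N U V) : R[i] :=
  (N (complex.Re `|z.1|) (complex.Re `|z.2|))%:C.

Let re_nrm (W : normedModType R[i]) (w : W) : (complex.Re `|w|)%:C = `|w|.
Proof. by rewrite RRe_real// ger0_real. Qed.

Let re_nrm_ge0 (W : normedModType R[i]) (w : W) : 0 <= complex.Re `|w|.
Proof. by rewrite -lecR re_nrm normr_ge0. Qed.

Lemma dsum_nrmD x y : dsum_nrm (x + y) <= dsum_nrm x + dsum_nrm y.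
Proof.
rewrite /dsum_nrm -rmorphD lecR; apply: le_trans (sumND _ _ _ _ _).
by apply: sumN_le; rewrite re_nrm_ge0/= -lecR rmorphD/= !re_nrm ler_normD.
Qed.

Lemma dsum_nrmZ a x : dsum_nrm (a *: x) = `|a| * dsum_nrm x.
Proof.
rewrite /dsum_nrm -[`|a| in RHS]/((normc a)%:C) -rmorphM/=; congr (_%:C).
have re_nrmZ (W : normedModType R[i]) (w : W) :
    complex.Re `|a *: w| = normc a * complex.Re `|w|.
  by apply: complexI; rewrite rmorphM/= !re_nrm normrZ.
by rewrite -[normc a in RHS]ger0_norm ?normc_ge0// -sumNZ -!re_nrmZ.
Qed.

Lemma dsum_nrm_eq0 x : dsum_nrm x = 0 -> x = 0.
Proof.
move=> /complexI/sumN_eq0[x1 x2]; case: x x1 x2 => x1 x2 /= h1 h2.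
by congr pair; apply/eqP; rewrite -normr_eq0 -re_nrm ?h1 ?h2.
Qed.

HB.instance Definition _ :=
  Lmodule_isNormed.Build R[i] (dsum N U V) dsum_nrmD dsum_nrmZ dsum_nrm_eq0.

Lemma dsum_normrE (z : dsum N U V) :
  `|z| = (N (complex.Re `|z.1|) (complex.Re `|z.2|))%:C.
Proof. by []. Qed.

End sum_norm.
Arguments sum_norm : clear implicits.

Section operators.
Context {K : numFieldType} (Y : normedModType K).

Definition Isom : set (Y -> Y) :=
  [set T | [/\ linear T, (forall x, `|T x| = `|x|) & range T = setT]].

Definition bounded_op : set (Y -> Y) :=
  [set T | linear T /\ bounded_near T (nbhs 0)].

Definition GLop : set (Y -> Y) :=
  [set T | bounded_op T /\ exists2 S, bounded_op S & cancel T S /\ cancel S T].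

End operators.
Arguments Isom {K} Y.
Arguments bounded_op {K} Y.
Arguments GLop {K} Y.

Section subspaces.
Context {K : fieldType} {E : lmodType K}.

Definition is_basis n (v : 'I_n -> E) (V : set E) : Prop :=
  (forall c : 'I_n -> K, \sum_(r < n) c r *: v r = 0 -> forall r, c r = 0) /\
  V = [set x | exists c : 'I_n -> K, x = \sum_(r < n) c r *: v r].

Definition has_dim (V : set E) (n : nat) : Prop :=
  exists v : 'I_n -> E, is_basis v V.

Definition Gr (n : nat) : set (set E) := [set V | has_dim V n].

End subspaces.

Section profile.
Context {R : realType} (N : sum_norm R) (p q : R) (p1 : 1 <= p) (q1 : 1 <= q).

Local Notation lpq := (dsum N (lp p1) (lp q1)).

Definition lpA : set lpq := [set z | z.2 = 0].
Definition lqB : set lpq := [set z | z.1 = 0].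

(* [inl] is the copy A of the naturals and [inr] the copy B.  An n-element set
   {i_1 < ... < i_n} of indices is an n-tuple that is strictly sorted for
   [idx_lt], which puts A before B; another total order would only change the
   sign of [plucker v I]. *)
Definition idx : Type := (nat + nat)%type.

Definition inA (i : idx) : bool := if i is inl _ then true else false.
Definition inB (i : idx) : bool := ~~ inA i.

Definition idx_lt : rel idx := fun i j =>
  match i, j with
  | inl a, inl b => (a < b)%N
  | inl _, inr _ => true
  | inr _, inl _ => false
  | inr a, inr b => (a < b)%N
  end.

Definition coord (z : lpq) (i : idx) : R[i] :=
  match i with inl a => z.1 a | inr b => z.2 b end.

Definition plucker n (v : 'I_n -> lpq) (I : n.-tuple idx) : R[i] :=
  \det (\matrix_(r < n, s < n) coord (v r) (tnth I s)).

Lemma coord_sum n (c : 'I_n -> R[i]) (v : 'I_n -> lpq) i :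
  coord (\sum_(r < n) c r *: v r) i = \sum_(r < n) c r * coord (v r) i.
Proof.
elim/big_ind2: _ => [|x x' y y' <- <-|r _].
- by case: i.
- by case: i => k; rewrite /coord ?dsumD1 ?dsumD2 lpD.
- by case: i => k; rewrite /coord ?dsumZ1 ?dsumZ2 lpZ.
Qed.

Lemma plucker_neq0 n (v w : 'I_n -> lpq) (V : set lpq) (I : n.-tuple idx) :
  is_basis v V -> is_basis w V -> plucker v I != 0 -> plucker w I != 0.
Proof.
move=> [_ Vv] [_ Vw]; apply: contraNneq => wI0.
have /choice[c vE] r : exists c : 'I_n -> R[i], v r = \sum_(s < n) c s *: w s.
  suff : V (v r) by rewrite Vw.
  rewrite Vv; exists (fun s => (s == r)%:R).
  by rewrite (bigD1 r)//= eqxx scale1r big1 ?addr0// => s /negPf ->; rewrite scale0r.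
rewrite /plucker (_ : \matrix_(r, s) _ =
    (\matrix_(r, s) c r s) *m (\matrix_(r, s) coord (w r) (tnth I s))).
  by rewrite det_mulmx -/(plucker w I) wI0 mulr0.
apply/matrixP => r s; rewrite !mxE vE coord_sum.
by apply: eq_bigr => t _; rewrite !mxE.
Qed.

(* By [plucker_neq0] the choice of the basis is irrelevant. *)
Definition prof n (V : set lpq) : set (nat * nat) :=
  [set ab | (ab.1 + ab.2 = n)%N /\ exists2 v : 'I_n -> lpq, is_basis v V &
    exists I : n.-tuple idx, [/\ sorted idx_lt I,
      count inA I = ab.1, count inB I = ab.2 & plucker v I != 0]].

Definition stratum n (alpha gamma : nat) : set (set lpq) :=
  [set V | [/\ Gr n V, has_dim (V `&` lpA) alpha & has_dim (V `&` lqB) gamma]].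

End profile.

(* Main.v *)
(** Let e_i be the unit vectors of X, indexed by A and B.  The projection P_i onto
    e_i is Hermitian: |x + it P_i x| <= (1 + t^2/2) |x|; hence so is T P_i T^-1 for
    an isometry T, and, averaging over sign changes of coordinates, so is each
    off-diagonal 2x2 block of this rank-one operator.  Comparing first-order
    expansions of the norm at vectors supported on two or three coordinates, such a
    block vanishes because p, q <> 2.  Therefore T maps every e_i to a unimodular
    multiple of some e_(f i).  The norms |e_i + e_j| are 2^(1/p), 2^(1/q) or N(1,1)
    according to the sides of i and j, and as p <> q this forces f to preserve A
    and B.

    If m is the largest number of indices in B among the tuples with nonzero
    Pluecker coordinate, then the intersection of V and l^p(A) has dimension n - m,
    so that the profile determines the stratum.

    For the orbit of GL(X): when v_r has coordinates delta_rs at I_s, the operator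
    x + sum_s x_(I_s) (v_s - e_(I_s)) is invertible and maps the span of the e_(I_s)
    onto that of the v_s; spans of disjoint families e_I and e_J are both related in
    this way to the span of the e_(I_s) + e_(J_s). *)

From HB Require Import structures.
Require Import Defs.
From mathcomp Require Import all_boot all_order all_algebra.
From mathcomp Require Import complex.
From mathcomp Require Import all_classical all_reals all_analysis.
From mathcomp Require Import ring lra zify.

Set Implicit Arguments.
Unset Strict Implicit.
Unset Printing Implicit Defensive.

Import Order.TTheory GRing.Theory Num.Theory.
Import numFieldNormedType.Exports.
Import Normc.

Local Open Scope classical_set_scope.
Local Open Scope ring_scope.
Local Open Scope complex_scope.

Local Notation coord := Defs.coord.

(** * Hermitian rank-one operators *)

HB.lock Definition pnorm2 (R : realType) (p s r : R) : R :=
  (s `^ p + r `^ p) `^ p^-1.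

Section powR_extra.
Context {R : realType}.
Implicit Types (p s r z : R).

(** Young's inequality for z and 1 with the exponents p and p / (p - 1); the case p = 1, whose
    conjugate exponent is infinite, is treated apart. *)
Lemma powR_bernoulli p z : 1 <= p -> 0 <= z -> 1 + p * (z - 1) <= z `^ p.
Proof.
move=> p1 z0; have [->|pn1] := eqVneq p 1; first by rewrite powRr1//; lra.
have p0 : 0 < p by lra.
have pm : 0 < p - 1 by rewrite subr_gt0 lt_neqAle eq_sym pn1.
have := @conjugate_powR _ z 1 p (p / (p - 1)) z0 ler01 p0 (divr_gt0 p0 pm).
rewrite powR1 mulr1 mul1r invf_div.
have -> : p^-1 + (p - 1) / p = 1 by field; rewrite gt_eqF.
move=> /(_ erefl); rewrite -(ler_pM2l p0) mulrDr.
have -> : p * (z `^ p / p) = z `^ p by field; rewrite gt_eqF.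
have -> : p * ((p - 1) / p) = p - 1 by field; rewrite gt_eqF.
lra.
Qed.

Lemma pnorm2_ge0 p s r : 0 <= pnorm2 p s r.
Proof. by rewrite unlock powR_ge0. Qed.

Lemma pnorm2_gt0 p s r : 0 < s -> 0 < r -> 0 < pnorm2 p s r.
Proof. by move=> s0 r0; rewrite unlock powR_gt0// addr_gt0// powR_gt0. Qed.

Lemma pnorm2K p s r : 1 <= p -> pnorm2 p s r `^ p = s `^ p + r `^ p.
Proof.
move=> p1; rewrite unlock -powRrM mulVf; last by rewrite gt_eqF//; lra.
by rewrite powRr1// addr_ge0// powR_ge0.
Qed.

(* Hoelder's inequality for two terms, read as: the norm [pnorm2 p] lies above its
   tangent plane at [(s, r)]. *)
Lemma pnorm2_tangent p s r s' r' : 1 <= p -> 0 < s -> 0 < r -> 0 <= s' -> 0 <= r' ->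
  s `^ (p - 1) * s' + r `^ (p - 1) * r' <= pnorm2 p s' r' * pnorm2 p s r `^ (p - 1).
Proof.
move=> p1 s0 r0 s'0 r'0; have p0 : 0 < p by lra.
have := pnorm2_gt0 p s0 r0; have := pnorm2_ge0 p s' r'.
move: (pnorm2K s r p1) (pnorm2K s' r' p1); move: (pnorm2 p s r) (pnorm2 p s' r') => H H'.
move=> HE H'E H'0 H0; have [z|nz] := eqVneq H' 0.
  move/eqP: H'E; rewrite eq_sym.
  rewrite z [0 `^ p]powR0 ?(gt_eqF p0)// paddr_eq0 ?powR_ge0//.
  move=> /andP[/eqP/powR_eq0_eq0-> /eqP/powR_eq0_eq0->].
  by rewrite !mulr0 mul0r addr0.
have [l l0 lE] : exists2 l : R, 0 < l & H' = l * H.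
  exists (H' / H); last by rewrite divfK// gt_eqF.
  by rewrite divr_gt0// lt_neqAle eq_sym nz.
(* Bernoulli's inequality at u' / (l u), multiplied by u^p. Scaling by the ratio l of the two norms
   makes the right-hand sides for the two coordinates add up to H^p. *)
have key (u u' : R) : 0 < u -> 0 <= u' ->
    u `^ p + p * (u `^ (p - 1) * u' / l - u `^ p) <= u' `^ p / l `^ p.
  move=> u0 u'0; have := powR_bernoulli p1 (divr_ge0 u'0 (ltW (mulr_gt0 l0 u0))).
  rewrite -(ler_pM2l (powR_gt0 p u0)).
  rewrite (_ : u `^ p * (u' / (l * u)) `^ p = u' `^ p / l `^ p); last first.
    rewrite -powRM ?divr_ge0 ?mulr_ge0 ?(ltW l0) ?(ltW u0)//.
    have -> : u * (u' / (l * u)) = u' / l by field; rewrite !gt_eqF.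
    rewrite powRM ?invr_ge0 ?(ltW l0)//.
    by rewrite -powR_inv1 ?(ltW l0)// -powRrM mulN1r powRN.
  move=> h; apply: le_trans h; rewrite le_eqVlt; apply/orP; left.
  rewrite -(mulr_powRB1 (ltW u0) p0); apply/eqP; field; rewrite !gt_eqF//.
have := lerD (key s s' s0 s'0) (key r r' r0 r'0).
rewrite -mulrDl.
have -> : (s' `^ p + r' `^ p) / l `^ p = s `^ p + r `^ p.
  rewrite -HE -H'E lE powRM ?(ltW H0) ?(ltW l0)//.
  by field; rewrite gt_eqF// powR_gt0.
move=> h.
have : p * ((s `^ (p - 1) * s' + r `^ (p - 1) * r') / l - (s `^ p + r `^ p)) <= 0.
  by rewrite mulrBr mulrDl; move: h; lra.
rewrite pmulr_rle0// subr_le0 ler_pdivrMr// => /le_trans; apply.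
by rewrite -HE -(mulr_powRB1 (ltW H0) p0) lE mulrC mulrA.
Qed.

End powR_extra.

Section real_norm.
Context {R : realType} {W : normedModType R[i]}.
Implicit Types (w : W).

(** The norm as a real number, so that real powers and [N] apply to it. *)
Definition rn w : R := complex.Re `|w|.

Lemma rnE w : (rn w)%:C = `|w|.
Proof. by rewrite /rn RRe_real// ger0_real. Qed.

Lemma rn_ge0 w : 0 <= rn w.
Proof. by rewrite -lecR rnE normr_ge0. Qed.

Lemma rnD w w' : rn (w + w') <= rn w + rn w'.
Proof. by rewrite -lecR rmorphD/= !rnE ler_normD. Qed.

Lemma rnZ a w : rn (a *: w) = normc a * rn w.
Proof. by apply: complexI; rewrite rmorphM/= !rnE normrZ. Qed.

Lemma rn0 : rn (0 : W) = 0.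
Proof. by rewrite /rn normr0. Qed.

End real_norm.

Lemma normcR (R : realType) (a : R) : normc a%:C = `|a|.
Proof. by rewrite /normc /= expr0n/= addr0 sqrtr_sqr. Qed.

(** * Coordinates and norms in l^p *)

Section lp_facts.
Context {R : realType} (p : R) (p1 : 1 <= p).
Implicit Types (x y : lp p1) (f g : nat -> R[i]).

Let p0 : 0 < p. Proof. exact: lt_le_trans ltr01 p1. Qed.

Definition psum f : \bar R := (\sum_(k <oo) (normc (f k) `^ p)%:E)%E.

Lemma psum_ge0 f : (0 <= psum f)%E.
Proof. by apply: nneseries_ge0 => k _ _; rewrite lee_fin powR_ge0. Qed.

Lemma lp_normE f : lp_norm p f = poweR (psum f) p^-1.
Proof.
rewrite /lp_norm Lnorm_counting//; congr poweR; apply: eq_eseriesr => k _ /=.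
by rewrite ger0_norm ?normc_ge0.
Qed.

Lemma psum_fin x : psum x \is a fin_num.
Proof.
have : (lp_norm p x < +oo)%E := lp_valP x.
rewrite lp_normE => /lty_poweRy; rewrite ge0_fin_numE ?psum_ge0//; apply.
by rewrite invr_eq0 gt_eqF.
Qed.

(** The p-th power of the norm, which is additive over disjoint supports. *)
Definition rpsum x : R := fine (psum x).

Lemma rpsum_ge0 x : 0 <= rpsum x.
Proof. by rewrite fine_ge0// psum_ge0. Qed.

Lemma rn_lp x : rn x = rpsum x `^ p^-1.
Proof. by rewrite /rn lp_normrE/= lp_normE fine_poweR. Qed.

Lemma rpsum_le x y : (forall k, normc (x k) <= normc (y k)) -> rpsum x <= rpsum y.
Proof.
move=> xy; rewrite fine_le ?psum_fin//.
apply: lee_nneseries => [k _ _|k _]; first by rewrite lee_fin powR_ge0.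
by rewrite lee_fin ge0_ler_powR ?nnegrE ?normc_ge0// ltW.
Qed.

Lemma rn_lp_le x y : (forall k, normc (x k) <= normc (y k)) -> rn x <= rn y.
Proof.
move=> /rpsum_le xy.
by rewrite !rn_lp ge0_ler_powR ?nnegrE ?rpsum_ge0// invr_ge0 ltW.
Qed.

Lemma psumD1 f k : psum f =
  ((normc (f k) `^ p)%:E + \sum_(0 <= j <oo | j != k) (normc (f j) `^ p)%:E)%E.
Proof. by rewrite /psum (@nneseriesD1 _ _ k)// => j _; rewrite lee_fin powR_ge0. Qed.

Definition delta k : nat -> R[i] := fun j => (j == k)%:R.

Lemma delta_lp k : delta k \in lp_pred p.
Proof.
rewrite unfold_in lp_normE poweR_lty// (psumD1 _ k) eseries0 ?adde0 ?ltry//.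
by move=> j _ jk; rewrite /delta (negPf jk) normc0 powR0 ?gt_eqF.
Qed.

Definition lp_e k : lp p1 := Lp p1 (delta_lp k).

Lemma lp_eE k j : lp_e k j = (j == k)%:R.
Proof. by []. Qed.

Lemma lp_ext x y : (forall k, x k = y k) -> x = y.
Proof. by move=> xy; apply: val_inj; apply/funext. Qed.

Lemma rpsumD1 x a k : x k = 0 -> rpsum (x + a *: lp_e k) = rpsum x + normc a `^ p.
Proof.
move=> xk; rewrite /rpsum -[normc a `^ p]/(fine (normc a `^ p)%:E).
rewrite -fineD ?psum_fin//; congr fine; rewrite !(psumD1 _ k).
rewrite lpD lpZ lp_eE eqxx mulr1 xk add0r normc0 powR0 ?gt_eqF//.
rewrite add0e addeC; congr (_ + _)%E; apply: eq_eseriesr => j /negPf jk.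
by rewrite lpD lpZ lp_eE jk mulr0 addr0.
Qed.

Lemma rpsum0 : rpsum 0 = 0.
Proof.
by rewrite /rpsum /psum eseries0// => k _ _; rewrite [_ k]/(0 : R[i]) normc0 powR0 ?gt_eqF.
Qed.

Lemma rn_lp_e a k : rn (a *: lp_e k) = normc a.
Proof.
rewrite -[_ *: _]add0r rn_lp rpsumD1// rpsum0 add0r -powRrM mulfV ?gt_eqF//.
by rewrite powRr1// normc_ge0.
Qed.

Lemma rn_lp_e2 a b j k : j != k ->
  rn (a *: lp_e j + b *: lp_e k) = pnorm2 p (normc a) (normc b).
Proof.
move=> jk; rewrite rn_lp rpsumD1; last by rewrite lpZ lp_eE eq_sym (negPf jk) mulr0.
by rewrite -[a *: _]add0r rpsumD1// rpsum0 add0r unlock.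
Qed.

Lemma rn_lp_lt x a k : x k = 0 -> a != 0 -> rn x < rn (x + a *: lp_e k).
Proof.
move=> xk a0; rewrite !rn_lp gt0_ltr_powR ?nnegrE ?rpsum_ge0 ?invr_gt0//.
rewrite rpsumD1// ltrDl powR_gt0// lt_neqAle normc_ge0 andbT eq_sym.
by apply: contra_neq a0 => /eq0_normc.
Qed.

End lp_facts.

(** * Coordinates of X, sign flips and Hermitian operators *)

Section coordinates.
Context {R : realType} (N : sum_norm R) (p q : R) (p1 : 1 <= p) (q1 : 1 <= q).
Local Notation X := (dsum N (lp p1) (lp q1)).
Implicit Types (x y : X) (i j k m : idx).

Definition e_ i : X :=
  match i with inl a => (lp_e p1 a, 0) | inr b => (0, lp_e q1 b) end.

Lemma coordD x y i : coord (x + y) i = coord x i + coord y i.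
Proof. by case: i => k; rewrite /coord ?dsumD1 ?dsumD2 lpD. Qed.

Lemma coordZ a x i : coord (a *: x) i = a * coord x i.
Proof. by case: i => k; rewrite /coord ?dsumZ1 ?dsumZ2 lpZ. Qed.

Lemma coordN x i : coord (- x) i = - coord x i.
Proof. by rewrite -scaleN1r coordZ mulN1r. Qed.

Lemma coord0 i : coord (0 : X) i = 0.
Proof. by case: i. Qed.

Lemma coord_e i j : coord (e_ i) j = (j == i)%:R.
Proof. by case: i j => [a|b] [c|d]. Qed.

Definition coordE := (coordD, coordN, coordZ, coord_e, coord0).

Lemma coord_ext x y : (forall i, coord x i = coord y i) -> x = y.
Proof.
case: x y => [x1 x2] [y1 y2] xy; congr pair; apply: lp_ext => k.
- exact: (xy (inl k)).
- exact: (xy (inr k)).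
Qed.

Lemma rn_dsum x : rn x = N (rn x.1) (rn x.2).
Proof. by rewrite /rn dsum_normrE. Qed.

Lemma sumN_l s : 0 <= s -> N s 0 = s.
Proof.
by move=> s0; rewrite -[s in LHS]mulr1 -[0](mulr0 s) sumNZ sumN10 mulr1 ger0_norm.
Qed.

Lemma sumN_r s : 0 <= s -> N 0 s = s.
Proof.
by move=> s0; rewrite -[s in LHS]mulr1 -[0](mulr0 s) sumNZ sumN01 mulr1 ger0_norm.
Qed.

Lemma rn_dsum_l (x : lp p1) : rn ((x, 0) : X) = rn x.
Proof. by rewrite rn_dsum /= rn0 sumN_l ?rn_ge0. Qed.

Lemma rn_dsum_r (y : lp q1) : rn ((0, y) : X) = rn y.
Proof. by rewrite rn_dsum /= rn0 sumN_r ?rn_ge0. Qed.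

Lemma rn_e a i : rn (a *: e_ i) = normc a.
Proof.
rewrite rnZ; case: i => k; rewrite ?rn_dsum_l ?rn_dsum_r -[lp_e _ _]scale1r rn_lp_e.
  by rewrite normc1 mulr1.
by rewrite normc1 mulr1.
Qed.

Lemma rn_dsum_le x y : (forall i, normc (coord x i) <= normc (coord y i)) ->
  rn x <= rn y.
Proof.
move=> xy; rewrite !rn_dsum; apply: sumN_le; rewrite rn_ge0/=; apply: rn_lp_le => k.
- exact: (xy (inl k)).
- exact: (xy (inr k)).
Qed.

Lemma eq_rn_dsum x y : (forall i, normc (coord x i) = normc (coord y i)) -> rn x = rn y.
Proof.
by move=> xy; apply/eqP; rewrite eq_le !rn_dsum_le// => i; rewrite xy.
Qed.

Lemma rn_dsum_lt x a i : coord x i = 0 -> a != 0 -> rn x < rn (x + a *: e_ i).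
Proof.
case: i x => k [x1 x2] /= xk a0; rewrite !rn_dsum; apply: sumN_mono;
  rewrite /= ?rn_ge0 ?scaler0 ?addr0 ?lexx ?ltW ?rn_lp_lt//.
- by move=> [] h; move: (rn_lp_lt xk a0); rewrite -h ltxx.
- by move=> [] h; move: (rn_lp_lt xk a0); rewrite -h ltxx.
Qed.

Lemma rn_coord x i : normc (coord x i) <= rn x.
Proof.
rewrite -(rn_e (coord x i) i).
apply: rn_dsum_le => m; rewrite !coordE; case: eqVneq => [->|_]; first by rewrite mulr1.
by rewrite mulr0 normc0 normc_ge0.
Qed.

Definition flip i x : X := x - (2 * coord x i) *: e_ i.

Lemma coord_flip i x m : coord (flip i x) m = if m == i then - coord x m else coord x m.
Proof.
rewrite /flip !coordE; case: eqP => [->|_]; last by rewrite mulr0 subr0.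
by rewrite mulr1; ring.
Qed.

Lemma rn_flip i x : rn (flip i x) = rn x.
Proof.
by apply: eq_rn_dsum => m; rewrite coord_flip; case: ifP => // _; rewrite normcN.
Qed.

(* Up to a constant, the property of being Hermitian (generating a one-parameter
   group of isometries); it is stable under conjugation by isometries. *)
Definition hermitian_op (C : R) (f : X -> X) := forall t x,
  rn (x + (t%:C * 'i) *: f x) <= (1 + C * t ^+ 2) * rn x.

Lemma eq_hermitian_op C f g : f =1 g -> hermitian_op C f -> hermitian_op C g.
Proof. by move=> fg hf t x; rewrite -fg; exact: hf. Qed.

Lemma hermitian_opN C f : hermitian_op C f -> hermitian_op C (fun x => - f x).
Proof. by move=> hf t x; rewrite scalerN -scaleNr -mulNr -rmorphN -sqrrN; exact: hf. Qed.

(** Only the i-th coordinate changes, by the factor 1 + it, whose modulus is at most 1 + t^2/2. *)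
Lemma hermitian_coord i : hermitian_op 2^-1 (fun x => coord x i *: e_ i).
Proof.
move=> t x; have c0 : 0 <= 1 + 2^-1 * t ^+ 2 by rewrite addr_ge0// mulr_ge0// ?invr_ge0// sqr_ge0.
rewrite -[X in X * rn x]ger0_norm// -normcR -rnZ; apply: rn_dsum_le => m.
rewrite !coordE; case: eqVneq => [->|_]; last first.
  rewrite !mulr0 addr0 normcM normcR ger0_norm// ler_peMl ?normc_ge0//.
  by rewrite lerDl mulr_ge0// ?invr_ge0// sqr_ge0.
rewrite mulr1 -{1}[coord x i]mul1r -mulrDl !normcM ler_wpM2r ?normc_ge0//.
rewrite normcR ger0_norm// -(@ler_pXn2r _ 2) ?nnegrE ?normc_ge0//.
rewrite /normc /= sqr_sqrtr ?addr_ge0 ?sqr_ge0//.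
have := sqr_ge0 (2^-1 * t ^+ 2); lra.
Qed.

Lemma hermitian_flip C j f : hermitian_op C f -> hermitian_op C (fun x => flip j (f (flip j x))).
Proof.
move=> hf t x; rewrite -(rn_flip j x) -(rn_flip j (x + _)).
rewrite (_ : flip j (x + _) = flip j x + (t%:C * 'i) *: f (flip j x)); first exact: hf.
apply: coord_ext => m; rewrite !(coord_flip, coordE).
by case: (m == j) => //; ring.
Qed.

Lemma hermitian_isom C (T S : X -> X) f : Isom X T -> cancel S T ->
  hermitian_op C f -> hermitian_op C (fun x => T (f (S x))).
Proof.
move=> [linT isoT _] ST hf t x.
have rT y : rn (T y) = rn y by rewrite /rn isoT.
have -> : x + (t%:C * 'i) *: T (f (S x)) = T (S x + (t%:C * 'i) *: f (S x)).
  by rewrite [in RHS]addrC linT ST addrC.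
by rewrite rT -[in X in _ <= _ * X](ST x) rT; exact: hf.
Qed.

(** The perturbed vector is the midpoint of those of f and g at parameter 2t; doubling t turns C
    into 4C. *)
Lemma hermitian_opD C f g : hermitian_op C f -> hermitian_op C g ->
  hermitian_op (4 * C) (fun x => f x + g x).
Proof.
move=> hf hg t x.
have -> : x + (t%:C * 'i) *: (f x + g x) = (2^-1 : R)%:C *:
    ((x + ((2 * t)%:C * 'i) *: f x) + (x + ((2 * t)%:C * 'i) *: g x)).
  by apply: coord_ext => m; rewrite !coordE fmorphV rmorphM rmorph_nat; field.
rewrite rnZ normcR ger0_norm ?invr_ge0//.
have := rnD (x + ((2 * t)%:C * 'i) *: f x) (x + ((2 * t)%:C * 'i) *: g x).
have := hf (2 * t) x; have := hg (2 * t) x; lra.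
Qed.

(* Averaging over the sign flips of [e_ j] and [e_ k] isolates the two entries of
   a rank-one operator in the positions [(j, k)] and [(k, j)]. *)
Lemma hermitian_offdiag C (phi : X -> R[i]) u j k : j != k ->
  (forall x a m, phi (x + a *: e_ m) = phi x + a * phi (e_ m)) ->
  hermitian_op C (fun x => phi x *: u) ->
  exists C', hermitian_op C' (fun x =>
    (4 * (coord u k * phi (e_ j)) * coord x j) *: e_ k +
    (4 * (coord u j * phi (e_ k)) * coord x k) *: e_ j).
Proof.
move=> jk phiD h; exists (4 * (4 * C)).
have h1 := hermitian_flip j h; have h2 := hermitian_flip k h.
have h3 := hermitian_flip k (hermitian_flip j h).
(* In this signed sum of conjugates the entry in position (a, b) is multiplied by (1 - s_j(a)
   s_j(b)) (1 - s_k(a) s_k(b)), where s_m is -1 at m and 1 elsewhere. This is 4 if {a, b} = {j, k},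
   and 0 otherwise. *)
apply: eq_hermitian_op (hermitian_opD (hermitian_opD h (hermitian_opN h1))
                                      (hermitian_opD (hermitian_opN h2) h3)) => x.
have phi_flip y m : phi (flip m y) = phi y - 2 * coord y m * phi (e_ m).
  by rewrite /flip -scaleNr phiD mulNr.
have kj : (k == j) = false by rewrite eq_sym (negPf jk).
apply: coord_ext => m; rewrite !(coord_flip, coordD, coordN) !phi_flip !coord_flip.
rewrite (negPf jk) ?kj !(coordZ, coord_e).
case: (eqVneq m j) => [->|_]; first by rewrite (negPf jk) mulr1n mulr0n; ring.
by case: (eqVneq m k) => [->|_]; rewrite ?mulr1n ?mulr0n; ring.
Qed.

End coordinates.

(** * First-order estimates; two coordinates of the same summand *)

Section offdiagonal.
Context {R : realType}.

Lemma Re_le_normc (z : R[i]) : complex.Re z <= normc z.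
Proof.
apply: le_trans (ler_norm _) _; rewrite -lecR; apply: le_trans (normc_ge_Re z) _.
by rewrite le_eqVlt eqxx.
Qed.

(** Multiplication by the unimodular inverse w' makes the main term s real without changing the
    modulus, which is then bounded below by the real part. *)
Lemma normc_ge_tangent (c w w' : R[i]) (s t : R) : w * w' = 1 -> normc w' = 1 ->
  s + t * complex.Re ('i * c * w') <= normc (s%:C * w + t%:C * 'i * c).
Proof.
move=> ww' w'1; rewrite -[leRHS]mulr1 -w'1 -normcM; apply: le_trans (Re_le_normc _).
have -> : (s%:C * w + t%:C * 'i * c) * w' = s%:C * (w * w') + t%:C * ('i * c * w') by ring.
rewrite ww' mulr1.
by case: ('i * c * w') => u v; rewrite /= mul0r subr0.
Qed.

(** The slope at 0 must vanish: at t = g / (2 (|M| + 1)) the right-hand side is at most half of t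
    g. *)
Lemma eq0_of_le_sqr (g M : R) : (forall t, t * g <= M * t ^+ 2) -> g = 0.
Proof.
move=> h; have M0 : 0 < `|M| + 1 by rewrite ltr_wpDl.
have := h (g / (2 * (`|M| + 1))); rewrite expr_div_n.
have -> : g / (2 * (`|M| + 1)) * g = g ^+ 2 / (2 * (`|M| + 1)) by ring.
rewrite mulrA ler_pdivlMr ?exprn_gt0 ?mulr_gt0//.
have -> : g ^+ 2 / (2 * (`|M| + 1)) * (2 * (`|M| + 1)) ^+ 2 =
   g ^+ 2 * (2 * (`|M| + 1)) by field; rewrite gt_eqF.
rewrite mulrC => h1; apply/eqP; rewrite -sqrf_eq0 eq_le sqr_ge0 andbT.
have := ler_norm M; have := sqr_ge0 g; have := normr_ge0 M; nra.
Qed.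

Lemma eq0_of_rotations (c : R[i]) : complex.Re ('i * c * 1) = 0 ->
  complex.Re ('i * c * 'i) = 0 -> c = 0.
Proof.
by case: c => u v /= h1 h2; apply/eqP; rewrite eq_complex /=; apply/andP; split;
  apply/eqP; lra.
Qed.

(** The choices w = 1 and w = i detect the imaginary and the real parts of both entries. *)
Lemma eq0_of_unimodular (a b : R[i]) :
  (forall w w', w * w' = 1 -> normc w = 1 -> normc w' = 1 ->
     complex.Re ('i * a * w') = 0 /\ complex.Re ('i * b * w) = 0) ->
  a = 0 /\ b = 0.
Proof.
have i1 : normc ('i : R[i]) = 1 by rewrite /normc /= expr0n expr1n add0r sqrtr1.
have ii : ('i : R[i]) * - 'i = 1 by rewrite mulrN -expr2 sqr_i opprK.
move=> h.
have [a1 b1] := h 1 1 (mulr1 1) (normc1 R) (normc1 R).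
have iN1 : normc (- 'i : R[i]) = 1 by rewrite normcN.
have [a2 b2] := h 'i (- 'i) ii i1 iN1.
split; apply: eq0_of_rotations => //.
by move: a2; rewrite mulrN; case: ('i * a * 'i) => u v /= /eqP; rewrite oppr_eq0 => /eqP.
Qed.

(** At the vector s e_j + r w e_k the first-order term is proportional to s^(p-1) r be + r^(p-1) s
    al, which therefore vanishes for all s, r > 0. Taking (1, 1) gives al = - be, and then (1, 2)
    gives be = 0 or 2 = 2^(p-1), the latter excluded by p <> 2. *)
Lemma lp_offdiag (p : R) (p1 : 1 <= p) (C : R) (a b : R[i]) j k :
  p != 2 -> j != k ->
  (forall t (x : lp p1), rn (x + (t%:C * 'i) *: ((a * x j) *: lp_e p1 k +
     (b * x k) *: lp_e p1 j)) <= (1 + C * t ^+ 2) * rn x) ->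
  a = 0 /\ b = 0.
Proof.
move=> p2 jk h; apply: eq0_of_unimodular => w w' ww' w1 w'1.
set al := complex.Re _; set be := complex.Re _.
have p0 : 0 < p by lra.
have balance (s r : R) : 0 < s -> 0 < r -> s `^ (p - 1) * (r * be) + r `^ (p - 1) * (s * al) = 0.
  move=> s0 r0; apply: (@eq0_of_le_sqr _ (C * (s `^ p + r `^ p))) => t.
  have := h t (s%:C *: lp_e p1 j + (r%:C * w) *: lp_e p1 k).
  set x := s%:C *: _ + _.
  have xj : x j = s%:C by rewrite lpD !lpZ !lp_eE eqxx (negPf jk) mulr0 addr0 mulr1.
  have xk : x k = r%:C * w.
    by rewrite lpD !lpZ !lp_eE eqxx eq_sym (negPf jk) mulr0 add0r mulr1.
  rewrite xj xk.
  have -> : x + (t%:C * 'i) *: ((a * s%:C) *: lp_e p1 k + (b * (r%:C * w)) *: lp_e p1 j)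
     = (s%:C * 1 + t%:C * 'i * (b * (r%:C * w))) *: lp_e p1 j +
       (r%:C * w + t%:C * 'i * (a * s%:C)) *: lp_e p1 k.
    by apply: lp_ext => m; rewrite !(lpD, lpZ, lp_eE); ring.
  rewrite /x !rn_lp_e2// mulr1 [normc (r%:C * w)]normcM w1 !normcR mulr1.
  rewrite (gtr0_norm s0) (gtr0_norm r0) => h1.
  set z1 := normc _ in h1; set z2 := normc _ in h1.
  have e1 : s + t * (r * be) <= z1.
    have := @normc_ge_tangent (b * (r%:C * w)) 1 1 s t (mulr1 _) (normc1 R).
    rewrite !mulr1; apply: le_trans; rewrite lerD2l.
    have -> : 'i * (b * (r%:C * w)) = r%:C * ('i * b * w) by ring.
    by rewrite /be; case: ('i * b * w) => u v /=; rewrite mul0r subr0.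
  have e2 : r + t * (s * al) <= z2.
    have := @normc_ge_tangent (a * s%:C) w w' r t ww' w'1.
    apply: le_trans; rewrite lerD2l.
    have -> : 'i * (a * s%:C) * w' = s%:C * ('i * a * w') by ring.
    by rewrite /al; case: ('i * a * w') => u v /=; rewrite mul0r subr0.
  (* After multiplication by the (p - 1)-st power of the norm at (s, r), the tangent plane bounds
     the left-hand side from below and the right-hand side becomes (1 + C t^2) (s^p + r^p). *)
  have := pnorm2_tangent p1 s0 r0 (normc_ge0 _ : 0 <= z1) (normc_ge0 _ : 0 <= z2).
  have h2 := ler_wpM2r (powR_ge0 (pnorm2 p s r) (p - 1)) h1.
  move=> /le_trans /(_ h2); rewrite -[_ * pnorm2 p s r * _]mulrA.
  rewrite mulr_powRB1 ?pnorm2_ge0// pnorm2K//.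
  have := ler_wpM2l (powR_ge0 s (p - 1)) e1; have := ler_wpM2l (powR_ge0 r (p - 1)) e2.
  rewrite !mulrDr ![_ `^ (p - 1) * s]mulrC ![_ `^ (p - 1) * r]mulrC.
  rewrite !mulr_powRB1 ?(ltW s0) ?(ltW r0)//; lra.
have := balance 1 1 ltr01 ltr01; rewrite powR1 !mul1r => ab.
have := balance 1 2 ltr01 (ltr0Sn _ 1); rewrite powR1 !mul1r.
have -> : al = - be by lra.
rewrite mulrN -mulrBl => /eqP; rewrite mulf_eq0 => /orP[|/eqP->]; last by rewrite oppr0.
rewrite subr_eq0 -{1}[2]powRr1// => /eqP h12; case/eqP: p2.
have : ln (2 `^ 1 : R) = ln (2 `^ (p - 1)) by rewrite h12.
rewrite !ln_powR => /(mulIf _) h3; suff : 1 = p - 1 by lra.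
by apply: h3; rewrite gt_eqF// ln_gt0// ltr1n.
Qed.

End offdiagonal.

(** * First-order behaviour of the sum norm *)

Section sum_norm_directions.
Context {R : realType} (N : sum_norm R) (S T : R).
Hypotheses (S0 : 0 < S) (T0 : 0 < T).

(* [(s, t)] is a direction along which [N] does not increase to first order at
   [(S, T)]; these directions form a linear space as [N] is convex. *)
Definition flat_dir (s t : R) := exists2 d : R, 0 < d & exists C : R, forall u,
  `|u| <= d -> N (S + u * s) (T + u * t) <= (1 + C * u ^+ 2) * N S T.

Let N0 : 0 < N S T.
Proof.
have <- : N 0 0 = 0 by have := sumNZ N 0 0 0; rewrite !mulr0 normr0 mul0r.
apply: sumN_mono; rewrite ?lexx ?(ltW S0) ?(ltW T0)//.
by move=> [] h; move: S0; rewrite h ltxx.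
Qed.

(** The point at parameter u along the sum is the midpoint of the points at parameter 2u along the
    two directions; hence the halved radius. *)
Lemma flat_dirD s t s' t' : flat_dir s t -> flat_dir s' t' -> flat_dir (s + s') (t + t').
Proof.
move=> [d d0 [C h]] [d' d'0 [C' h']]; exists (Num.min d d' / 2).
  by rewrite divr_gt0// lt_min d0.
exists (2 * (C + C')) => u; rewrite ler_pdivlMr// le_min => /andP[ud ud'].
have n2 : `|2 * u| = `|u| * 2 by rewrite normrM ger0_norm// mulrC.
have := h (2 * u); have := h' (2 * u); rewrite n2 => /(_ ud') h1 /(_ ud) h2.
have -> : S + u * (s + s') = 2^-1 * ((S + 2 * u * s) + (S + 2 * u * s')) by field.
have -> : T + u * (t + t') = 2^-1 * ((T + 2 * u * t) + (T + 2 * u * t')) by field.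
rewrite sumNZ ger0_norm ?invr_ge0//.
have := sumND N (S + 2 * u * s) (T + 2 * u * t) (S + 2 * u * s') (T + 2 * u * t').
lra.
Qed.

Lemma flat_dirZ c s t : flat_dir s t -> flat_dir (c * s) (c * t).
Proof.
move=> [d d0 [C h]]; have c0 : 0 < `|c| + 1 by rewrite ltr_wpDl.
exists (d / (`|c| + 1)); first by rewrite divr_gt0.
exists (C * c ^+ 2) => u; rewrite ler_pdivlMr// => ud.
rewrite (mulrA u c s) (mulrA u c t); have := h (u * c); rewrite exprMn => h1.
have -> : C * c ^+ 2 * u ^+ 2 = C * (u ^+ 2 * c ^+ 2) by ring.
apply: h1; rewrite normrM (le_trans _ ud)// ler_wpM2l//; lra.
Qed.

(** Otherwise strict monotonicity gives a positive gap between N at (S, T) and at (S, T) - e (s, t).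
    By convexity N then grows beyond (S, T) at a rate of at least gap / e, against the quadratic
    bound. *)
Lemma flat_dir_ge0 s t : 0 <= s -> 0 <= t -> flat_dir s t -> s = 0 /\ t = 0.
Proof.
move=> s0 t0 [d d0 [C h]]; apply: contrapT => st.
have s1 : 0 < s + 1 by lra.
have t1 : 0 < t + 1 by lra.
(* Small enough for the point (S - e s, T - e t) to stay in the quadrant; the + 1 avoids a zero
   denominator. *)
pose e := Num.min (S / (s + 1)) (T / (t + 1)).
have e0 : 0 < e by rewrite lt_min !divr_gt0.
have eS : e * s <= S.
  rewrite (@le_trans _ _ (e * (s + 1)))//; first by rewrite ler_pM2l//; lra.
  by rewrite -ler_pdivlMr// ge_min lexx.
have eT : e * t <= T.
  rewrite (@le_trans _ _ (e * (t + 1)))//; first by rewrite ler_pM2l//; lra.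
  by rewrite -ler_pdivlMr// ge_min lexx orbT.
have es0 : 0 <= e * s by rewrite mulr_ge0// ltW.
have et0 : 0 <= e * t by rewrite mulr_ge0// ltW.
have gap : N (S - e * s) (T - e * t) < N S T.
  apply: sumN_mono; [by apply/andP; split; lra..|].
  move=> [] h1 h2; apply: st.
  have /eqP : e * s = 0 by lra.
  have /eqP : e * t = 0 by lra.
  by rewrite !mulf_eq0 (gt_eqF e0)/= => /eqP-> /eqP->.
set g := N (S - _) _ in gap.
have C0 : 0 < `|C| + 1 by rewrite ltr_wpDl.
have M0 : 0 < 2 * e * (`|C| + 1) * N S T by rewrite !mulr_gt0.
(* Small enough for the quadratic term e C u N(S, T) to be at most half of the gap, whereas
   convexity makes it at least the whole gap. *)
pose u := Num.min d ((N S T - g) / (2 * e * (`|C| + 1) * N S T)).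
have u0 : 0 < u by rewrite lt_min d0 divr_gt0// subr_gt0.
have ud : `|u| <= d by rewrite ger0_norm ?(ltW u0)// ge_min lexx.
have ug : u * (2 * e * (`|C| + 1) * N S T) <= N S T - g.
  by rewrite -ler_pdivlMr// ge_min lexx orbT.
have := h u ud; have := sumND N (u * (S - e * s)) (u * (T - e * t))
  (e * (S + u * s)) (e * (T + u * t)).
have -> : u * (S - e * s) + e * (S + u * s) = (u + e) * S by ring.
have -> : u * (T - e * t) + e * (T + u * t) = (u + e) * T by ring.
rewrite !sumNZ -/g !ger0_norm ?addr_ge0 ?(ltW u0) ?(ltW e0)//.
set n1 := N (S + _) _; move=> h1 h2.
have h3 : e * n1 <= e * ((1 + C * u ^+ 2) * N S T) by rewrite ler_pM2l.
have h4 : u * (N S T - g) <= u * (e * C * u * N S T) by lra.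
move: h4; rewrite ler_pM2l// => h4.
have h5 : e * C * u * N S T <= u * (e * (`|C| + 1) * N S T).
  rewrite (_ : e * C * u * N S T = u * (e * C * N S T)); last by ring.
  rewrite ler_pM2l// ler_pM2r// ler_pM2l//; have := ler_norm C; lra.
lra.
Qed.

(** Scaling by s itself replaces s by s^2, which is nonnegative whatever the sign of s. *)
Lemma flat_dir_horizontal s : flat_dir s 0 -> s = 0.
Proof.
move=> /(flat_dirZ s); rewrite mulr0 -expr2 => /(flat_dir_ge0 (sqr_ge0 _) (lexx _))[].
by move/eqP; rewrite sqrf_eq0 => /eqP.
Qed.

Lemma flat_dir_vertical t : flat_dir 0 t -> t = 0.
Proof.
move=> /(flat_dirZ t); rewrite mulr0 -expr2 => /(flat_dir_ge0 (lexx _) (sqr_ge0 _))[_].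
by move/eqP; rewrite sqrf_eq0 => /eqP.
Qed.

(** The radius keeps S + u s and T + u t nonnegative, as the monotonicity of N requires. *)
Lemma flat_dir_le s t C : (forall u, exists S' T', [/\ S + u * s <= S',
    T + u * t <= T' & N S' T' <= (1 + C * u ^+ 2) * N S T]) -> flat_dir s t.
Proof.
move=> h; have s1 : 0 < `|s| + 1 by rewrite ltr_wpDl.
have t1 : 0 < `|t| + 1 by rewrite ltr_wpDl.
exists (Num.min (S / (`|s| + 1)) (T / (`|t| + 1))); first by rewrite lt_min !divr_gt0.
exists C => u; rewrite le_min !ler_pdivlMr// => /andP[uS uT].
have [S' [T' [hS hT hN]]] := h u; apply: le_trans hN; apply: sumN_le; apply/andP; split => //.
  have := ler_norm (- (u * s)); rewrite normrN normrM; have := normr_ge0 u; lra.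
have := ler_norm (- (u * t)); rewrite normrN normrM; have := normr_ge0 u; lra.
Qed.

End sum_norm_directions.

(** * One coordinate in each summand *)

Section mixed.
Context {R : realType} (N : sum_norm R).

(** With S = 2^(1/p), the vectors S e_c + w e_d and e_c + e_(c+1) + w e_d both have norm N(S, 1),
    but yield the different flat directions (be, S al) and (S^(1-p) be, al) at (S, 1). Subtracting S
    times the second from the first leaves the horizontal direction (1 - S^(2-p)) be, so be = 0 as p
    <> 2; what remains is vertical, so al = 0. *)
Lemma mixed_offdiag (p q : R) (p1 : 1 <= p) (q1 : 1 <= q) (C : R) (a b : R[i]) c d :
  p != 2 ->
  (forall t (x : lp p1) (y : lp q1),
     N (rn (x + (t%:C * 'i * (b * y d)) *: lp_e p1 c))
       (rn (y + (t%:C * 'i * (a * x c)) *: lp_e q1 d))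
     <= (1 + C * t ^+ 2) * N (rn x) (rn y)) ->
  a = 0 /\ b = 0.
Proof.
move=> p2 h; apply: eq0_of_unimodular => w w' ww' w1 w'1.
set al := complex.Re _; set be := complex.Re _.
have p0 : 0 < p by lra.
have Re_s (s : R) (z : R[i]) : complex.Re (s%:C * z) = s * complex.Re z.
  by case: z => u v /=; rewrite mul0r subr0.
pose S := pnorm2 p 1 1.
have Sp : S `^ p = 2 by rewrite pnorm2K// powR1.
have S0 : 0 < S by exact: (pnorm2_gt0 p ltr01 ltr01).
have yd : (w *: lp_e q1 d) d = w by rewrite lpZ lp_eE eqxx mulr1.
have dir1 : flat_dir N S 1 be (S * al).
  apply: (@flat_dir_le _ _ _ _ S0 ltr01 _ _ C) => t.
  have := h t (S%:C *: lp_e p1 c) (w *: lp_e q1 d).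
  rewrite yd lpZ lp_eE eqxx mulr1 -!scalerDl !rn_lp_e normcR (gtr0_norm S0) w1 => ht.
  exists (normc (S%:C + t%:C * 'i * (b * w))), (normc (w + t%:C * 'i * (a * S%:C))).
  split => //.
    have := @normc_ge_tangent _ (b * w) 1 1 S t (mulr1 _) (normc1 R).
    by rewrite !mulr1 (mulrA 'i b w) -/be.
  have := @normc_ge_tangent _ (a * S%:C) w w' 1 t ww' w'1.
  by rewrite mul1r (_ : 'i * _ * w' = S%:C * ('i * a * w')) ?Re_s//; ring.
have dir2 : flat_dir N S 1 (S `^ (1 - p) * be) al.
  apply: (@flat_dir_le _ _ _ _ S0 ltr01 _ _ C) => t.
  have cc : c != c.+1 by rewrite neq_ltn ltnSn.
  have := h t (1 *: lp_e p1 c + 1 *: lp_e p1 c.+1) (w *: lp_e q1 d).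
  rewrite yd lpD !lpZ !lp_eE eqxx (negPf cc) mulr0 addr0 mulr1 addrAC -!scalerDl.
  rewrite !rn_lp_e2// !rn_lp_e normc1 w1 mulr1 -/S => ht.
  exists (pnorm2 p (normc (1 + t%:C * 'i * (b * w))) 1), (normc (w + t%:C * 'i * a)).
  split => //; last first.
    by have := @normc_ge_tangent _ a w w' 1 t ww' w'1; rewrite mul1r.
  have e1 : 1 + t * be <= normc (1 + t%:C * 'i * (b * w)).
    have := @normc_ge_tangent _ (b * w) 1 1 1 t (mulr1 _) (normc1 R).
    by rewrite !mulr1 (mulrA 'i b w) -/be.
  (* The tangent plane at (1, 1), multiplied by S^(1-p); its constant term is 2 S^(1-p) = S. *)
  have := pnorm2_tangent p1 ltr01 ltr01 (normc_ge0 (1 + t%:C * 'i * (b * w))) ler01.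
  rewrite powR1 !mul1r -/S => e2.
  have Sm : 0 < S `^ (1 - p) by rewrite powR_gt0.
  have S1 : S `^ (p - 1) * S `^ (1 - p) = 1.
    by rewrite -powRD ?(gt_eqF S0) ?implybT// addrC subrKA subrr powRr0.
  have SE : S = 2 * S `^ (1 - p).
    by rewrite -{1}Sp -powRD ?(gt_eqF S0) ?implybT// addrC subrK powRr1// ltW.
  have e3 : 2 + t * be <= pnorm2 p (normc (1 + t%:C * 'i * (b * w))) 1 * S `^ (p - 1) by lra.
  have := ler_wpM2r (ltW Sm) e3; rewrite -[_ * _ * S `^ (1 - p)]mulrA S1 mulr1.
  apply: le_trans; rewrite [X in X + _]SE le_eqVlt; apply/orP; left; apply/eqP; ring.
have := flat_dirD dir1 (flat_dirZ (- S) dir2).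
rewrite !mulNr subrr mulrA => /(flat_dir_horizontal S0 ltr01).
rewrite -[X in X - _]mul1r -mulrBl => /eqP; rewrite mulf_eq0 => /orP[|/eqP be0].
  rewrite subr_eq0 -{1}[S]powRr1 ?(ltW S0)// -powRD ?(gt_eqF S0) ?implybT//.
  move=> /eqP/(congr1 (@ln R)); rewrite ln1 ln_powR => /esym/eqP.
  rewrite mulf_eq0 => /orP[/eqP|]; first by move/eqP: p2; lra.
  rewrite ln_eq0// => /eqP S1; move: Sp; rewrite S1 powR1; lra.
split => //; move: dir1; rewrite be0 => /(flat_dir_vertical S0 ltr01)/eqP.
by rewrite mulf_eq0 (gt_eqF S0) => /eqP.
Qed.

Context (p q : R) (p1 : 1 <= p) (q1 : 1 <= q).
Local Notation X := (dsum N (lp p1) (lp q1)).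

Let offdiag (a b : R[i]) j k := fun x : X =>
  (a * coord x j) *: e_ N p1 q1 k + (b * coord x k) *: e_ N p1 q1 j.

Lemma hermitian_offdiag_eq0 (C : R) (a b : R[i]) j k : p != 2 -> q != 2 -> j != k ->
  hermitian_op C (offdiag a b j k) -> a = 0 /\ b = 0.
Proof.
move=> p2 q2; have mix a' b' c d : hermitian_op C (offdiag a' b' (inl c) (inr d)) ->
    a' = 0 /\ b' = 0.
  move=> h; apply: (@mixed_offdiag p q p1 q1 C a' b' c d p2) => t x y.
  have := h t (x, y); rewrite !rn_dsum /offdiag /=.
  by rewrite !scaler0 add0r addr0 !scalerA.
case: j k => [c|c] [d|d] jk h.
- apply: (@lp_offdiag _ p p1 C a b c d p2); first by apply: contra_neq jk => ->.
  move=> t x; have := h t (x, 0); rewrite !rn_dsum /offdiag /=.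
  by rewrite !scaler0 !addr0 !scaler0 !addr0 rn0 !sumN_l ?rn_ge0.
- exact: (mix a b c d).
- have [] := mix b a d c; last by [].
  by apply: eq_hermitian_op h => x; rewrite /offdiag addrC.
- apply: (@lp_offdiag _ q q1 C a b c d q2); first by apply: contra_neq jk => ->.
  move=> t x; have := h t (0, x); rewrite !rn_dsum /offdiag /=.
  by rewrite !scaler0 !addr0 !scaler0 !addr0 rn0 !sumN_r ?rn_ge0.
Qed.

End mixed.

(** * Isometries permute the coordinates *)

Section linear_maps.
Context {K : pzRingType} {U V : lmodType K} {f : U -> V} (linf : linear f).

Let fL : {linear U -> V} := HB.pack f (GRing.isLinear.Build _ _ _ _ f linf).

Lemma lin_zero : f 0 = 0. Proof. exact: (raddf0 fL). Qed.

Lemma lin_add x y : f (x + y) = f x + f y. Proof. exact: (raddfD fL). Qed.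

Lemma lin_sub x y : f (x - y) = f x - f y. Proof. exact: (raddfB fL). Qed.

Lemma lin_scale a x : f (a *: x) = a *: f x. Proof. by rewrite -[f]/(fL : _ -> _) linearZ. Qed.

Lemma lin_comb n (c : 'I_n -> K) (v : 'I_n -> U) :
  f (\sum_(r < n) c r *: v r) = \sum_(r < n) c r *: f (v r).
Proof. by rewrite -[f]/(fL : _ -> _) linear_sum; apply: eq_bigr => r _; rewrite linearZ. Qed.

End linear_maps.

Section isometries.
Context {K : numFieldType} {Y : normedModType K}.

Lemma isom_inverse (T : Y -> Y) : Isom Y T ->
  exists S, [/\ Isom Y S, cancel T S & cancel S T].
Proof.
move=> [linT isoT surT].
have /choice[S ST] y : exists x, T x = y.
  by have [x _ <-] : range T y; [rewrite surT|exists x].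
have injT : injective T.
  move=> x y xy; apply/eqP; rewrite -subr_eq0 -normr_eq0 -isoT.
  by rewrite (lin_sub linT) xy subrr normr0.
have TS : cancel T S by move=> x; apply: injT; rewrite ST.
exists S; split => //; split.
- by move=> a x y; apply: injT; rewrite linT !ST.
- by move=> x; rewrite -[in RHS](ST x) isoT.
- by apply/seteqP; split => // x _; exists (T x).
Qed.

End isometries.

Section monomial.
Context {R : realType} (N : sum_norm R) (p q : R) (p1 : 1 <= p) (q1 : 1 <= q).
Hypotheses (pq : p != q) (p2 : p != 2) (q2 : q != 2).
Local Notation X := (dsum N (lp p1) (lp q1)).
Local Notation e := (e_ N p1 q1).

Lemma dsum_neq0 (x : X) : x != 0 -> exists i, coord x i != 0.
Proof.
move=> x0; apply: contrapT => h; case/eqP: x0; apply: coord_ext => i; rewrite coord0.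
by apply/eqP/negPn/negP => xi; apply: h; exists i.
Qed.

Section inverse_pair.
Variables (T S : X -> X).
Hypotheses (isoT : Isom X T) (isoS : Isom X S) (TS : cancel T S) (ST : cancel S T).

Let linT : linear T. Proof. by case: isoT. Qed.
Let linS : linear S. Proof. by case: isoS. Qed.

Let rnT x : rn (T x) = rn x.
Proof. by case: isoT => _ h _; rewrite /rn h. Qed.

(** Conjugating the i-th coordinate projection by T gives the Hermitian operator x |-> (S x)_i T
    e_i. The product is one of its off-diagonal entries. *)
Lemma isom_entries i j k : j != k -> coord (T (e i)) k * coord (S (e j)) i = 0.
Proof.
move=> jk; have h := hermitian_isom isoT ST (@hermitian_coord _ N _ _ p1 q1 i).
have {}h : hermitian_op 2^-1 (fun x => coord (S x) i *: T (e i)).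
  by apply: eq_hermitian_op h => x; rewrite (lin_scale linT).
have [|C hC] := hermitian_offdiag jk _ h.
  by move=> x a m; rewrite (lin_add linS) (lin_scale linS) !coordE.
have [+ _] := hermitian_offdiag_eq0 p2 q2 jk hC.
by move/eqP; rewrite mulf_eq0 pnatr_eq0 => /eqP.
Qed.

Lemma isom_e_neq0 i : T (e i) != 0.
Proof.
apply/eqP => h; have := rnT (e i).
by rewrite h rn0 -[e i]scale1r rn_e normc1 => /esym/eqP; rewrite oner_eq0.
Qed.

End inverse_pair.

(** If T e_i has a nonzero coordinate k, then [isom_entries] for S forces S e_k to be supported at
    i; its coordinate there is nonzero, so the same lemma for T forces T e_i to be supported at
    k. *)
Lemma isom_e (T S : X -> X) (isoT : Isom X T) (isoS : Isom X S)
    (TS : cancel T S) (ST : cancel S T) i :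
  exists k c, normc c = 1 /\ T (e i) = c *: e k.
Proof.
have [k Tik] := dsum_neq0 (isom_e_neq0 isoT i).
have Sk j : j != i -> coord (S (e k)) j = 0.
  move=> ji; have := isom_entries isoS isoT TS k (j := i) (k := j).
  rewrite eq_sym => /(_ ji)/eqP; rewrite mulf_eq0 (negPf Tik) orbF => /eqP//.
have Ski : coord (S (e k)) i != 0.
  have [j Skj] := dsum_neq0 (isom_e_neq0 isoS k).
  by have [<-//|/Sk/eqP] := eqVneq j i; rewrite (negPf Skj).
have TE : T (e i) = coord (T (e i)) k *: e k.
  apply: coord_ext => j; rewrite coordZ coord_e.
  have [->|jk] := eqVneq j k; first by rewrite mulr1.
  have := isom_entries isoT isoS ST i (j := k) (k := j).
  rewrite eq_sym => /(_ jk)/eqP; rewrite mulf_eq0 (negPf Ski) orbF mulr0 => /eqP//.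
exists k, (coord (T (e i)) k); split => //.
rewrite -(rn_e N p1 q1 _ k) -TE; case: isoT => _ h _.
by rewrite /rn h -/(rn (e i)) -[e i]scale1r rn_e normc1.
Qed.

Let P : R := 2 `^ p^-1.
Let Q : R := 2 `^ q^-1.

Lemma rn_e2 a b i j : i != j -> normc a = 1 -> normc b = 1 ->
  rn (a *: e i + b *: e j) =
  if inA i == inA j then (if inA i then P else Q) else N 1 1.
Proof.
move=> ij a1 b1; rewrite rn_dsum; case: i j ij => [i|i] [j|j] /= ij;
  rewrite ?scaler0 ?addr0 ?add0r ?rn0 ?rn_lp_e ?a1 ?b1//.
- rewrite sumN_l ?rn_ge0// rn_lp_e2; last by apply: contra_neq ij => ->.
  by rewrite a1 b1 unlock powR1.
- rewrite sumN_r ?rn_ge0// rn_lp_e2; last by apply: contra_neq ij => ->.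
  by rewrite a1 b1 unlock powR1.
Qed.

Lemma two_powRV_inj : P != Q.
Proof.
apply/eqP => /(congr1 (@ln R)); rewrite !ln_powR => /mulIf h; case/eqP: pq.
by apply: invr_inj; apply: h; rewrite gt_eqF// ln_gt0// ltr1n.
Qed.

(* The norm of [e i + e j] tells apart pairs inside A, pairs inside B and mixed
   pairs, except that [N 1 1] may be one of the first two values. *)
Lemma side_preserved (f : idx -> idx) : injective f ->
  (forall i j, i != j -> rn (e (f i) + e (f j)) = rn (e i + e j)) ->
  forall i, inA (f i) = inA i.
Proof.
move=> injf h.
pose v (s : bool) : R := if s then P else Q.
have vN s s' : s != s' -> v s != v s'.
  by case: s s' => [] [] // _; rewrite /v ?[Q == _]eq_sym two_powRV_inj.
have rnE i j : i != j ->
    rn (e i + e j) = if inA i == inA j then v (inA i) else N 1 1.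
  by move=> ij; have := rn_e2 ij (normc1 R) (normc1 R); rewrite !scale1r.
have {}h i j : i != j ->
    (if inA (f i) == inA (f j) then v (inA (f i)) else N 1 1) =
    (if inA i == inA j then v (inA i) else N 1 1).
  by move=> ij; rewrite -!rnE ?h//; apply: contra_neq ij => /injf.
pose mk (s : bool) (n : nat) : idx := if s then inl n else inr n.
have inA_mk s n : inA (mk s n) = s by case: s.
have mk_neq s n : mk s n != mk s n.+1.
  by case: s; apply/eqP => -[] /eqP; rewrite eqn_leq ltnn andbF.
move=> i; apply/eqP/negPn/negP => fi.
have [i' i'i inAi'] : exists2 i', i != i' & inA i' = inA i.
  exists (mk (inA i) (match i with inl n => n | inr n => n end).+1);
    last exact: inA_mk.
  by case: (i) => n; [exact: (mk_neq true n)|exact: (mk_neq false n)].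
(* If both images had changed sides, the norm of a pair inside one summand would equal that of a
   pair inside the other. Hence exactly one crosses, and N(1, 1) is the value for the side of i. *)
have fi' : inA (f i') != inA (f i).
  apply: contraNneq (vN _ _ fi) => fi'.
  by have := h _ _ i'i; rewrite fi' inAi' !eqxx => ->.
have vM : v (inA i) = N 1 1.
  by have := h _ _ i'i; rewrite eq_sym (negPf fi') inAi' eqxx => ->.
(* On the other side not both of two indices can cross, for the same reason. With a j that stays,
   the mixed pair i, j is sent into the side of j, so that N(1, 1) is the value for that side
   too. *)
have [j inAj fj] : exists2 j, inA j = ~~ inA i & inA (f j) = ~~ inA i.
  pose j := mk (~~ inA i) 0; pose j' := mk (~~ inA i) 1.
  have [fj|fj] := eqVneq (inA (f j)) (~~ inA i); first by exists j; rewrite ?inA_mk.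
  have [fj'|fj'] := eqVneq (inA (f j')) (~~ inA i); first by exists j'; rewrite ?inA_mk.
  have := h j j' (mk_neq _ _); rewrite !inA_mk eqxx.
  have -> : inA (f j) = inA i by move: fj; case: (inA (f j)) (inA i) => [] [].
  have -> : inA (f j') = inA i by move: fj'; case: (inA (f j')) (inA i) => [] [].
  rewrite eqxx => /eqP; rewrite (negPf (vN _ _ _))//.
  by case: (inA i).
have ij : i != j by apply/eqP => ij; move: inAj; rewrite -ij; case: (inA i).
have := h i j ij; rewrite inAj fj.
have -> : inA (f i) = ~~ inA i by move: fi; case: (inA (f i)) (inA i) => [] [].
rewrite eqxx -vM; case: ifP => _ /eqP; by rewrite (negPf (vN _ _ _))//; case: (inA i).
Qed.

(** Stated for all x, since finite combinations of unit vectors do not exhaust X. *)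
Definition monomial_on (f : idx -> idx) (c : idx -> R[i]) (T : X -> X) :=
  [/\ bijective f, forall i, inA (f i) = inA i, forall i, c i != 0 &
     forall x i, coord (T x) (f i) = c i * coord x i].

Lemma isom_monomial (T : X -> X) : Isom X T -> exists f c, monomial_on f c T.
Proof.
move=> isoT; have [S [isoS TS ST]] := isom_inverse isoT.
have /choice[f /choice[c cf]] := isom_e isoT isoS TS ST.
have /choice[g /choice[d dg]] := isom_e isoS isoT ST TS.
have [linT nT _] := isoT; have [linS _ _] := isoS.
have TD := lin_add linT; have TZ := lin_scale linT; have SZ := lin_scale linS.
have neq0 a : normc a = 1 -> a != 0 :> R[i].
  by move=> a1; apply/eqP => a0; move: a1; rewrite a0 normc0 => /esym/eqP; rewrite oner_eq0.
have e_inj a i j : e i = a *: e j -> i = j.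
  move=> ij; apply/eqP; have := congr1 (fun z : X => coord z i) ij.
  rewrite coordZ !coord_e eqxx; case: eqP => // _ /eqP.
  by rewrite mulr0 oner_eq0.
have gf : cancel f g.
  move=> i; apply/esym/(@e_inj (c i * d (f i))).
  by have [_ h] := cf i; rewrite -{1}(TS (e i)) h SZ; have [_ ->] := dg (f i); rewrite scalerA.
have fg : cancel g f.
  move=> i; apply/esym/(@e_inj (d i * c (g i))).
  by have [_ h] := dg i; rewrite -{1}(ST (e i)) h TZ; have [_ ->] := cf (g i); rewrite scalerA.
have rT x : rn (T x) = rn x by rewrite /rn nT.
exists f, c; split.
- by exists g.
- apply: side_preserved => [|i j ij]; first exact: can_inj gf.
  rewrite -[RHS]rT TD; have [ci ->] := cf i; have [cj ->] := cf j.
  have fij : f i != f j by apply: contra_neq ij => /(can_inj gf).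
  by rewrite rn_e2// -[X in rn (X + _)]scale1r -[X in rn (_ + X)]scale1r rn_e2 ?normc1.
- by move=> i; apply: neq0; have [] := cf i.
- move=> x i; have [ci hi] := cf i; have c0 := neq0 _ ci.
  have [z zi ->] : exists2 z, coord z i = 0 & x = z + coord x i *: e i.
    by exists (x - coord x i *: e i); rewrite ?subrK// !coordE eqxx mulr1 subrr.
  rewrite TD TZ hi scalerA !coordE !eqxx !mulr1 zi add0r mulrC.
  (* If w is this coordinate, T maps z - (w/c_i) e_i to u and z + (w/c_i) e_i to u + 2w e_(f i). The
     arguments have equal norms because z_i = 0; the images do not unless w = 0, by strict
     monotonicity. *)
  suff -> : coord (T z) (f i) = 0 by rewrite add0r.
  set w := coord _ _; apply/eqP/negPn/negP => w0.
  pose u := T z - w *: e (f i).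
  have u0 : coord u (f i) = 0 by rewrite !coordE eqxx mulr1 subrr.
  have w20 : 2 * w != 0 by rewrite mulf_neq0// pnatr_eq0.
  have := rn_dsum_lt u0 w20.
  have TE s : T (z + (s / c i) *: e i) = T z + s *: e (f i).
    by rewrite TD TZ hi scalerA divfK.
  have -> : u + (2 * w) *: e (f i) = T (z + (w / c i) *: e i).
    by rewrite TE /u -addrA -scaleNr -scalerDl; congr (_ + _ *: _); ring.
  have -> : u = T (z + (- w / c i) *: e i) by rewrite TE scaleNr.
  suff E : rn (z + (- w / c i) *: e i) = rn (z + (w / c i) *: e i) by rewrite !rT E ltxx.
  apply: eq_rn_dsum => j; rewrite !coordD !coordZ !coord_e.
  case: eqVneq => [->|_]; last by rewrite !mulr0.
  by rewrite zi !add0r !mulr1 mulNr normcN.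
Qed.

End monomial.

(** * The profile and the dimensions of the intersections *)

Section dimension.
Context {K : fieldType} {E F : lmodType K}.

Lemma is_basis_image n (v : 'I_n -> E) (V : set E) (f : E -> F) :
  linear f -> injective f -> is_basis v V -> is_basis (f \o v) (f @` V).
Proof.
move=> linf injf [free_v ->]; split=> [c /=|].
  rewrite -(lin_comb linf) => f0; apply: free_v; apply: injf.
  by rewrite f0 (lin_zero linf).
apply/seteqP; split => [_ [_ [c ->] <-]|_ [c ->]].
  by exists c; rewrite (lin_comb linf).
by exists (\sum_(r < n) c r *: v r); [exists c|rewrite (lin_comb linf)].
Qed.

Lemma has_dim_image n (V : set E) (f : E -> F) :
  linear f -> injective f -> has_dim V n -> has_dim (f @` V) n.
Proof. by move=> linf injf [v vV]; exists (f \o v); exact: is_basis_image. Qed.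

Lemma basis_mem n (v : 'I_n -> E) (V : set E) r : is_basis v V -> V (v r).
Proof.
move=> [_ ->]; exists (fun s => (s == r)%:R).
by rewrite (bigD1 r)//= eqxx scale1r big1 ?addr0// => s /negPf ->; rewrite scale0r.
Qed.

(** If m < n, the n x m matrix of coefficients has a nonzero left kernel vector, which is a linear
    relation between the v_r. *)
Lemma has_dim_le n m (V W : set E) : V `<=` W -> has_dim V n -> has_dim W m -> (n <= m)%N.
Proof.
move=> VW [v vV] [w wW].
have /choice[c vE] r : exists c : 'I_m -> K, v r = \sum_(s < m) c s *: w s.
  by have := VW _ (basis_mem r vV); case: wW => _ ->.
rewrite leqNgt; apply/negP => mn.
pose A : 'M[K]_(n, m) := \matrix_(r, s) c r s.
have : kermx A != 0.
  by rewrite -mxrank_eq0 mxrank_ker subn_eq0 -ltnNge (leq_ltn_trans (rank_leq_col A)).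
case/rowV0Pn => u /sub_kermxP uA /eqP; apply; apply/rowP => r; rewrite mxE.
apply: (vV.1 (fun r => u 0 r)); under eq_bigr do rewrite vE scaler_sumr.
rewrite exchange_big big1// => s _; under eq_bigr do rewrite scalerA.
rewrite -scaler_suml (_ : \sum_(i < n) u 0 i * c i s = 0) ?scale0r//.
have /rowP/(_ s) := uA; rewrite !mxE => us; rewrite -[RHS]us.
by apply: eq_bigr => i _; rewrite !mxE.
Qed.

Lemma has_dim_uniq n m (V : set E) : has_dim V n -> has_dim V m -> n = m.
Proof. by move=> Vn Vm; apply/eqP; rewrite eqn_leq !(@has_dim_le _ _ V V). Qed.

End dimension.

Section profile.
Context {R : realType} (N : sum_norm R) (p q : R) (p1 : 1 <= p) (q1 : 1 <= q).
Local Notation X := (dsum N (lp p1) (lp q1)).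
Local Notation C := R[i].

(** Treats the two summands alike: l^p(A) is [zero_on inB] and l^q(B) is [zero_on inA]. *)
Definition zero_on (D : pred idx) : set X := [set z | forall i, D i -> coord z i = 0].

Lemma lpA_zero_on : @lpA R N p q p1 q1 = zero_on inB.
Proof.
apply/seteqP; split => [z /= z0 [//|k] _|[z1 z2] z0]; first by rewrite /coord z0.
by apply: lp_ext => k; exact: (z0 (inr k)).
Qed.

Lemma lqB_zero_on : @lqB R N p q p1 q1 = zero_on inA.
Proof.
apply/seteqP; split => [z /= z0 [k|//] _|[z1 z2] z0]; first by rewrite /coord z0.
by apply: lp_ext => k; exact: (z0 (inl k)).
Qed.

Section columns.
Context {n : nat} (v : 'I_n -> X).

(** The i-th coordinate functional on the span of v. Pluecker coordinates are determinants of n such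
    rows, and intersections with [zero_on D] are common kernels of the rows indexed by D. *)
Definition coord_row (i : idx) : 'rV[C]_n := \row_r coord (v r) i.

Lemma coord_row_comb m (I : m.-tuple idx) (k : 'I_m -> C) :
  \sum_(s < m) k s *: (map_tuple coord_row I)`_s =
  (\row_s k s) *m (\matrix_(s < m) coord_row (tnth I s)).
Proof.
rewrite mulmx_sum_row; apply: eq_bigr => s _; rewrite mxE rowK.
by rewrite -tnth_nth tnth_map.
Qed.

Lemma plucker_free (I : n.-tuple idx) :
  (plucker v I != 0) = free (map coord_row I).
Proof.
have -> : plucker v I = \det (\matrix_(s < n) coord_row (tnth I s)).
  by rewrite -det_tr; congr (\det _); apply/matrixP => r s; rewrite !mxE.
set M := \matrix_(s < n) _.
rewrite -[map _ _]/(tval (map_tuple coord_row I)).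
apply/idP/freeP => [M0 k|frI].
  rewrite coord_row_comb => kM s; have /rowP/(_ s) : \row_s k s = 0.
    apply: (row_free_inj (A := M)); last by rewrite mul0mx.
    by rewrite row_free_unit unitmxE unitfE.
  by rewrite !mxE.
apply/negP => /det0P[k /eqP k0 kM]; apply: k0; apply/rowP => s; rewrite mxE.
apply: frI => //; rewrite coord_row_comb (_ : \row_s _ = k)//.
by apply/rowP => j; rewrite mxE.
Qed.

Lemma free_size (Y : seq 'rV[C]_n) : free Y -> (size Y <= n)%N.
Proof.
rewrite /free => /eqP <-; rewrite (leq_trans (dimvS (subvf _)))//.
by rewrite dimvf /dim/= mul1n.
Qed.

(** Rows outside the current span are added one at a time; this stops because a free family has at
    most n members. *)
Lemma free_extension (D : pred idx) (Y : seq 'rV[C]_n) : free Y ->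
  exists L, [/\ all D L, free (map coord_row L ++ Y) &
    forall i, D i -> coord_row i \in <<map coord_row L ++ Y>>%VS].
Proof.
have [m] := ubnP (n - size Y); elim: m Y => // m IH Y mY frY.
have [h|] := pselect (forall i, D i -> coord_row i \in <<Y>>%VS); first by exists [::].
move=> /existsNP[i /not_implyP[Di /negP Yi]].
have frY' : free (coord_row i :: Y) by rewrite free_cons Yi.
have sY : (size Y < n)%N := free_size frY'.
have [|L [DL frL spanL]] := IH (coord_row i :: Y) _ frY'; first by rewrite /=; lia.
have eqL : perm_eq (map coord_row L ++ coord_row i :: Y) (map coord_row (i :: L) ++ Y).
  by rewrite perm_catC /= perm_cons perm_catC.
exists (i :: L); split; first by rewrite /= Di.
  by rewrite -(perm_free eqL).
move=> j /spanL; rewrite (@eq_span _ _ _ (map coord_row (i :: L) ++ Y))//.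
exact: perm_mem.
Qed.

Lemma coord_comb (c : 'I_n -> C) i :
  coord (\sum_(r < n) c r *: v r) i = ((\row_r c r) *m (coord_row i)^T) 0 0.
Proof. by rewrite coord_sum mxE; apply: eq_bigr => r _; rewrite !mxE. Qed.

(** In the basis v the intersection is the kernel of the matrix of the rows in L, which has rank
    [size L]; the other rows indexed by D are combinations of these. *)
Lemma has_dim_zero_on (V : set X) (D : pred idx) (L : seq idx) : is_basis v V ->
  all D L -> free (map coord_row L) ->
  (forall i, D i -> coord_row i \in <<map coord_row L>>%VS) ->
  has_dim (V `&` zero_on D) (n - size L).
Proof.
move=> [frv ->] DL frL spanL.
pose I := in_tuple L; pose M := \matrix_(s < size L) coord_row (tnth I s).
have rkM : \rank M = size L.
  apply/eqP; rewrite -[_ == _]/(row_free M) -kermx_eq0.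
  apply/rowV0P => u /sub_kermxP uM; apply/rowP => s; rewrite mxE.
  have /freeP : free (map_tuple coord_row I) by [].
  apply => //; rewrite coord_row_comb -[RHS]uM; congr (_ *m _).
  by apply/rowP => j; rewrite mxE.
pose B := row_base (kermx M^T).
have rkB : \rank (kermx M^T) = (n - size L)%N by rewrite mxrank_ker mxrank_tr rkM.
have zeroP (c : 'I_n -> C) : zero_on D (\sum_(r < n) c r *: v r) <->
    (\row_r c r) *m M^T = 0.
  split=> [z|cM i Di].
    apply/rowP => s; rewrite mxE [RHS]mxE.
    have := z (tnth I s) (allP DL _ (mem_tnth s I)).
    rewrite coord_comb mxE => h; rewrite -[RHS]h.
    by apply: eq_bigr => r _; rewrite !mxE.
  have /coord_span : coord_row i \in <<map_tuple coord_row I>>%VS by exact: spanL.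
  rewrite coord_row_comb coord_comb => ->; rewrite trmx_mul mulmxA cM mul0mx mxE//.
rewrite -rkB; exists (fun s => \sum_(r < n) B s r *: v r).
have BE (c : 'I_(\rank (kermx M^T)) -> C) :
    \sum_s c s *: (\sum_(r < n) B s r *: v r) = \sum_(r < n) ((\row_s c s) *m B) 0 r *: v r.
  under eq_bigr do rewrite scaler_sumr; rewrite exchange_big; apply: eq_bigr => r _.
  under eq_bigr do rewrite scalerA; rewrite -scaler_suml; congr (_ *: _).
  by rewrite mxE; apply: eq_bigr => s _; rewrite !mxE.
split=> [c|].
  rewrite BE => /frv c0 s.
  have /rowP/(_ s) : \row_s c s = 0.
    apply: (row_free_inj (row_base_free (kermx M^T))); rewrite mul0mx.
    by apply/rowP => r; rewrite c0 mxE.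
  by rewrite !mxE.
apply/seteqP; split => [_ [[c ->] /zeroP cM]|_ [c ->]].
  have : (\row_r c r <= B)%MS by rewrite eq_row_base; apply/sub_kermxP.
  move=> /submxP[d dE]; exists (fun s => d 0 s); rewrite BE.
  have -> : \row_s d 0 s = d by apply/rowP => s; rewrite mxE.
  by rewrite -dE; apply: eq_bigr => r _; rewrite mxE.
rewrite BE; split; first by eexists.
apply/zeroP; rewrite (_ : \row_r _ = \row_s c s *m B); last first.
  by apply/rowP => r; rewrite mxE.
by apply/sub_kermxP; rewrite -(eq_row_base (kermx M^T)) submxMl.
Qed.

(* A greedy choice of independent coordinates in [D], completed outside [D],
   realizes the largest possible number of [D]-coordinates. *)
Lemma profile_max (V : set X) (D : pred idx) : is_basis v V ->
  exists m, [/\ (m <= n)%N, has_dim (V `&` zero_on D) (n - m),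
    exists2 I : n.-tuple idx, plucker v I != 0 & count D I = m &
    forall I : n.-tuple idx, plucker v I != 0 -> (count D I <= m)%N].
Proof.
move=> vV; have [L [DL frL spanL]] := free_extension D (nil_free _).
rewrite cats0 in frL spanL.
have [L' [DL' frL' spanL']] := free_extension (predC D) frL.
rewrite -map_cat in frL' spanL'.
have span_all i : predT i -> coord_row i \in <<map coord_row (L' ++ L)>>%VS.
  have [Di _|Di _] := boolP (D i); last exact: spanL'.
  apply: (subvP _ _ (spanL _ Di)); apply: sub_span => w.
  by rewrite map_cat mem_cat => ->; rewrite orbT.
have sL : (size (L' ++ L) <= n)%N by have := free_size frL'; rewrite size_map.
(* The rows of L' ++ L span all rows, so n - [size (L' ++ L)] is the dimension of the vectors of V
   with all coordinates zero. *)
have {}sL : size (L' ++ L) == n.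
  rewrite eqn_leq sL /= -subn_eq0; apply/eqP.
  have h := has_dim_zero_on vV (all_predT _) frL' span_all.
  apply: (has_dim_uniq h); exists (fun _ => 0); split => [c _ []//|].
  apply/seteqP; split => [z [_ z0]|z [c ->]]; last first.
    rewrite big_ord0; split; last by move=> i _; rewrite coord0.
    case: vV => _ ->; exists (fun => 0); rewrite big1// => r _; exact: scale0r.
  exists (fun=> 0); rewrite big_ord0; apply: coord_ext => i.
  by rewrite coord0; exact: z0.
exists (size L); split.
- by rewrite -(eqP sL) size_cat leq_addl.
- exact: has_dim_zero_on.
- exists (Tuple sL); first by rewrite plucker_free.
  rewrite /= count_cat (eqP (_ : count D L == size L)) -?all_count//.
  rewrite (_ : count D L' = 0%N)// -[RHS](count_pred0 L'); apply/eq_in_count => i iL'.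
  by apply/negbTE/(allP DL').
- move=> I; rewrite plucker_free => frI.
  (* The rows of I indexed by D are independent and lie in the span of the rows of L, so there are
     at most [size L] of them. *)
  have frDI : free (map coord_row [seq i <- I | D i]).
    apply: (catl_free (Y := map coord_row [seq i <- I | ~~ D i])).
    rewrite -map_cat (perm_free (Y := map coord_row I))// perm_map//.
    by rewrite perm_filterC.
  rewrite -size_filter -(size_map coord_row) -(eqP frDI : \dim _ = _).
  rewrite -(size_map coord_row L) -(eqP frL : \dim _ = _); apply: dimvS.
  by apply/span_subvP => w /mapP[j]; rewrite mem_filter => /andP[Dj _] ->; exact: spanL.
Qed.

(** Independence of rows survives reordering and excludes repeated indices, so the sorted tuple is
    strictly sorted, as [prof] demands. *)
Lemma plucker_sort (I : n.-tuple idx) : plucker v I != 0 ->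
  exists J : n.-tuple idx, [/\ sorted idx_lt J, perm_eq I J & plucker v J != 0].
Proof.
rewrite plucker_free => frI.
pose le := [rel i j | (i == j) || idx_lt i j].
have lt_tr : transitive idx_lt.
  by move=> [a|a] [b|b] [c|c] //=; exact: ltn_trans.
have le_tr : transitive le.
  move=> j i k /= /predU1P[->//|ij] /predU1P[<-|jk]; first by rewrite ij orbT.
  by rewrite (lt_tr _ _ _ ij jk) orbT.
have le_tot : total le.
  by move=> [a|a] [b|b] //=; case: (ltngtP a b) => [_|_|->]; rewrite ?eqxx ?orbT.
exists [tuple of sort le I]; split => /=; last 2 first.
- by rewrite perm_sym perm_sort.
- rewrite plucker_free (perm_free (Y := map coord_row I))//.
  by rewrite perm_map// perm_sort.
have uI : uniq (sort le I) by rewrite sort_uniq (map_uniq (free_uniq frI)).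
have := sort_sorted le_tot I.
rewrite (sorted_pairwise le_tr) (sorted_pairwise lt_tr) => pI.
move: uI; rewrite uniq_pairwise => /(conj pI)/andP; rewrite -pairwise_relI.
by apply: sub_pairwise => i j /= /andP[/predU1P[->|//]]; rewrite eqxx.
Qed.

End columns.
End profile.

(** * The orbit of GL(X) *)

Section bounded_operators.
Context {K : numFieldType} {Y : normedModType K}.

Lemma bounded_opP (f : Y -> Y) : linear f ->
  bounded_op Y f <-> exists2 M, 0 <= M & forall x, `|f x| <= M * `|x|.
Proof.
move=> linf; split=> [[_ fb]|[M M0 fM]].
  pose fL : {linear Y -> Y} := HB.pack f (GRing.isLinear.Build _ _ _ _ f linf).
  have /linear_boundedP/pinfty_ex_gt0[M M0 fM] : bounded_near fL (nbhs 0) by [].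
  by exists M => //; exact: ltW.
split=> //; apply/ex_bound; exists M; apply/nbhs_norm0P; exists 1 => //= x /= x1.
by rewrite (le_trans (fM x))// ler_piMr// ltW.
Qed.

Lemma bounded_op_comp (f g : Y -> Y) :
  bounded_op Y f -> bounded_op Y g -> bounded_op Y (f \o g).
Proof.
move=> bf bg; have [linf _] := bf; have [ling _] := bg.
have linfg : linear (f \o g) by move=> a x y; rewrite /= ling linf.
have /(bounded_opP linf)[M M0 fM] := bf; have /(bounded_opP ling)[M' M'0 gM'] := bg.
apply/(bounded_opP linfg); exists (M * M') => [|x /=]; first exact: mulr_ge0.
by rewrite (le_trans (fM _))// -mulrA ler_wpM2l.
Qed.

Definition GL_equiv (V W : set Y) := exists2 g, GLop Y g & g @` V = W.

Lemma GL_equiv_sym V W : GL_equiv V W -> GL_equiv W V.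
Proof.
move=> [g [bg [h bh [gh hg]]] <-]; exists h; first by split => //; exists g.
apply/seteqP; split => [_ [_ [x Vx <-] <-]|x Vx]; first by rewrite gh.
by exists (g x); rewrite ?gh//; exists x.
Qed.

Lemma GL_equiv_trans V W Z : GL_equiv V W -> GL_equiv W Z -> GL_equiv V Z.
Proof.
move=> [g [bg [h bh [gh hg]]] <-] [g' [bg' [h' bh' [gh' hg']]] <-].
exists (g' \o g); last by rewrite image_comp.
split; first exact: bounded_op_comp.
exists (h \o h'); first exact: bounded_op_comp.
by split => x /=; rewrite ?gh' ?gh ?hg ?hg'.
Qed.

End bounded_operators.

Definition lin_span (K : fieldType) (E : lmodType K) n (v : 'I_n -> E) : set E :=
  [set x | exists c : 'I_n -> K, x = \sum_(r < n) c r *: v r].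

Section orbit.
Context {R : realType} (N : sum_norm R) (p q : R) (p1 : 1 <= p) (q1 : 1 <= q).
Local Notation X := (dsum N (lp p1) (lp q1)).
Local Notation C := R[i].
Local Notation e := (e_ N p1 q1).

(* The operator is [1 + A] with [A ^ 2 = 0], hence has the inverse [1 - A]. *)
Lemma GL_equiv_transvection n (I : 'I_n -> idx) (v : 'I_n -> X) :
  (forall r s, coord (v r) (I s) = (r == s)%:R) ->
  GL_equiv (lin_span (e \o I)) (lin_span v).
Proof.
move=> vI; pose w s := v s - e (I s).
have injI s t : (I s == I t) = (s == t).
  apply/eqP/eqP => [st|-> //]; apply/eqP; have := vI s s; rewrite st vI eqxx.
  by case: eqP => // _ /eqP; rewrite eq_sym oner_eq0.
have wI s t : coord (w s) (I t) = 0.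
  by rewrite !coordE vI injI eq_sym subrr.
pose A a (z : X) := z + a *: (\sum_(s < n) coord z (I s) *: w s).
have linA a : linear (A a).
  move=> b x y; rewrite /A; have -> : \sum_s coord (b *: x + y) (I s) *: w s =
      b *: (\sum_s coord x (I s) *: w s) + \sum_s coord y (I s) *: w s.
    rewrite scaler_sumr -big_split; apply: eq_bigr => s _.
    by rewrite coordD coordZ scalerDl scalerA.
  rewrite !scalerDr !scalerA (mulrC a) -!addrA; congr (_ + _).
  by rewrite addrCA.
have bA a : bounded_op X (A a).
  apply/(bounded_opP (linA a)); exists (1 + `|a| * \sum_(s < n) `|w s|) => [|x].
    by rewrite addr_ge0// mulr_ge0// sumr_ge0.
  rewrite /A (le_trans (ler_normD _ _))// mulrDl mul1r lerD2l normrZ -mulrA.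
  rewrite ler_wpM2l// (le_trans (ler_norm_sum _ _ _))// mulr_suml ler_sum// => s _.
  by rewrite normrZ mulrC ler_wpM2l// -rnE lecR rn_coord.
(* The w_s vanish at every I_t, so [A a] preserves the coordinates from which its correction term is
   built. *)
have coordA a x t : coord (A a x) (I t) = coord x (I t).
  rewrite coordD coordZ coord_sum big1 ?mulr0 ?addr0// => s _.
  by rewrite wI mulr0.
have AK a b : a + b = 0 -> cancel (A a) (A b).
  move=> ab x; rewrite {1}/A; under eq_bigr do rewrite coordA.
  by rewrite /A -addrA -scalerDl ab scale0r addr0.
exists (A 1).
  split; first exact: bA.
  by exists (A (- 1)); [exact: bA|split; apply: AK; rewrite ?subrr ?addNr].
have Ae s : A 1 (e (I s)) = v s.
  rewrite /A (bigD1 s)//= big1 => [|t ts].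
    by rewrite coord_e eqxx scale1r addr0 scale1r /w subrKC.
  by rewrite coord_e injI (negPf ts) scale0r.
have Asum c : A 1 (\sum_(r < n) c r *: e (I r)) = \sum_(r < n) c r *: v r.
  by rewrite (lin_comb (linA 1)); apply: eq_bigr => r _; rewrite Ae.
apply/seteqP; split => [_ [_ [c ->] <-]|_ [c ->]].
  by exists c; rewrite -Asum.
by exists (\sum_(r < n) c r *: e (I r)); [exists c|rewrite -Asum].
Qed.

(** The inverse of the Pluecker submatrix turns v into a basis of V whose coordinates at I form the
    identity matrix. *)
Lemma GL_equiv_coordinates n (v : 'I_n -> X) (V : set X) (I : n.-tuple idx) :
  is_basis v V -> plucker v I != 0 -> GL_equiv (lin_span (e \o tnth I)) V.
Proof.
move=> [frv ->]; rewrite -/(lin_span v) -unitfE -[_ \is a _]unitmxE.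
set M := \matrix_(r, s) _ => uM.
pose v' r := \sum_(s < n) invmx M r s *: v s.
have <- : lin_span v' = lin_span v.
  apply/seteqP; split => [_ [c ->]|_ [c ->]].
    exists (fun s => ((\row_r c r) *m invmx M) 0 s).
    under eq_bigr do rewrite scaler_sumr; rewrite exchange_big; apply: eq_bigr => s _.
    under eq_bigr do rewrite scalerA; rewrite -scaler_suml; congr (_ *: _).
    by rewrite mxE; apply: eq_bigr => r _; rewrite !mxE.
  exists (fun s => ((\row_r c r) *m M) 0 s).
  under [RHS]eq_bigr do rewrite scaler_sumr; rewrite exchange_big; apply: eq_bigr => s _.
  under [RHS]eq_bigr do rewrite scalerA; rewrite -scaler_suml; congr (_ *: _).
  have /rowP/(_ s) := mulmxK uM (\row_r c r); rewrite !mxE => <-.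
  by apply: eq_bigr => r _; rewrite !mxE.
apply: GL_equiv_transvection => r s; rewrite coord_sum.
have /matrixP/(_ r s) := mulVmx uM; rewrite !mxE => <-.
by apply: eq_bigr => t _; rewrite !mxE.
Qed.

Lemma GL_equiv_disjoint n (I J : 'I_n -> idx) : injective I -> injective J ->
  (forall s t, I s != J t) -> GL_equiv (lin_span (e \o I)) (lin_span (e \o J)).
Proof.
move=> injI injJ IJ; pose v s := e (I s) + e (J s).
apply: (@GL_equiv_trans _ _ _ (lin_span v)); [|apply: GL_equiv_sym];
  apply: GL_equiv_transvection => r s; rewrite coordD !coord_e.
  by rewrite (negPf (IJ _ _)) addr0 (inj_eq injI) eq_sym.
by rewrite eq_sym (negPf (IJ _ _)) add0r (inj_eq injJ) eq_sym.
Qed.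

Lemma Gr_orbit n : exists2 V0 : set X, Gr n V0 & Gr n = [set g @` V0 | g in GLop X].
Proof.
pose i0 (s : 'I_n) : idx := inl (nat_of_ord s).
have Gr0 : Gr n (lin_span (e \o i0)).
  exists (e \o i0); split => // c c0 r; have := congr1 (fun z : X => coord z (i0 r)) c0.
  rewrite coord_sum coord0 (bigD1 r)// [coord _ _]coord_e eqxx mulr1.
  rewrite big1 => [|s /andP[_ sr]]; first by rewrite /= addr0.
  rewrite [coord _ _]coord_e (_ : (_ == _) = false) ?mulr0//.
  by apply: contraNF sr => /eqP[]/ord_inj ->.
exists (lin_span (e \o i0)) => //; apply/seteqP; split => [V [v vV]|_ [g [bg [h _ [gh _]]] <-]].
  have [m [_ _ [I vI _] _]] := profile_max predT vV.
  suff [g Gg gV] : GL_equiv (lin_span (e \o i0)) V by exists g.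
  apply: GL_equiv_trans (GL_equiv_coordinates vV vI).
  pose ix (i : idx) := match i with inl a => a | inr b => b end.
  (* Larger than every index in I and in [i0], so that J is disjoint from both and links them. *)
  pose M := (n + \sum_(s < n) ix (tnth I s)).+1.
  pose J (s : 'I_n) : idx := inl (M + s)%N.
  have injJ : injective J by move=> s t [] /addnI/ord_inj.
  apply: (@GL_equiv_trans _ _ _ (lin_span (e \o J))).
    apply: GL_equiv_disjoint => // [s t []/ord_inj//|s t].
    apply/eqP => -[]; have := ltn_ord s; rewrite /M; lia.
  apply: GL_equiv_disjoint => // [|s t].
    apply/tuple_uniqP; move: vI; rewrite plucker_free => /free_uniq; exact: map_uniq.
  apply/eqP => /(congr1 ix); rewrite /= /M (bigD1 t)//=; lia.
have [ling _] := bg; apply: has_dim_image => //; exact: can_inj gh.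
Qed.

End orbit.

(** * The isometry group *)

Section isometry_group.
Context {R : realType} (N : sum_norm R) (p q : R) (p1 : 1 <= p) (q1 : 1 <= q).
Hypotheses (pq : p != q) (p2 : p != 2) (q2 : q != 2).
Local Notation X := (dsum N (lp p1) (lp q1)).

Lemma eq_normr_rn (W : normedModType R[i]) (w w' : W) : rn w = rn w' -> `|w| = `|w'|.
Proof. by move=> ww'; rewrite -!rnE ww'. Qed.

Lemma isom_zero_on (T : X -> X) (D : pred idx) : Isom X T ->
  (D =1 inA \/ D =1 inB) -> forall z, zero_on D z -> zero_on D (T z).
Proof.
move=> /(isom_monomial pq p2 q2)[f [c [[g gf fg] sf _ Tf]]] DE z z0 i Di.
rewrite -(fg i) Tf z0 ?mulr0//; move: Di; rewrite -{1}(fg i).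
by case: DE => DE; rewrite !DE /inB sf.
Qed.

Lemma isom_lpA (T : X -> X) x : Isom X T -> (T (x, 0)).2 = 0.
Proof.
move=> isoT; have : zero_on (N := N) inB ((x, 0) : X) by rewrite -lpA_zero_on.
by move/(isom_zero_on isoT (or_intror (frefl _))); rewrite -lpA_zero_on.
Qed.

Lemma isom_lqB (T : X -> X) y : Isom X T -> (T (0, y)).1 = 0.
Proof.
move=> isoT; have : zero_on (N := N) inA ((0, y) : X) by rewrite -lqB_zero_on.
by move/(isom_zero_on isoT (or_introl (frefl _))); rewrite -lqB_zero_on.
Qed.

Lemma isom_dsum : Isom X =
  [set (fun z : X => (U z.1, W z.2)) | U in Isom (lp p1) & W in Isom (lp q1)].
Proof.
apply/seteqP; split => [T isoT|_ [U [linU nU sU] [W [linW nW sW] <-]]]; last first.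
  split=> [a x y|z|]; first by congr pair; rewrite /= ?dsumD1 ?dsumD2 ?dsumZ1 ?dsumZ2 ?linU ?linW.
    by apply: eq_normr_rn; rewrite !rn_dsum /= /rn nU nW.
  apply/seteqP; split => // -[x y] _.
  have [x' _ <-] : range U x by rewrite sU.
  have [y' _ <-] : range W y by rewrite sW.
  by exists (x', y').
have [S [isoS TS ST]] := isom_inverse isoT.
have [linT nT _] := isoT.
pose U x := (T (x, 0)).1; pose W y := (T (0, y)).2.
have TU x : T (x, 0) = (U x, 0) by rewrite /U; case: (T _) (isom_lpA x isoT) => u w /= ->.
have TW y : T (0, y) = (0, W y) by rewrite /W; case: (T _) (isom_lqB y isoT) => u w /= ->.
(* The inverse also preserves the summands, which makes U and W surjective. *)
have SU x : S (x, 0) = ((S (x, 0)).1, 0) by case: (S _) (isom_lpA x isoS) => u w /= ->.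
have SW y : S (0, y) = (0, (S (0, y)).2) by case: (S _) (isom_lqB y isoS) => u w /= ->.
have addl x y a : ((a *: x + y, 0) : X) = a *: ((x, 0) : X) + ((y, 0) : X).
  by congr pair; rewrite /= scaler0 addr0.
have addr x y a : ((0, a *: x + y) : X) = a *: ((0, x) : X) + ((0, y) : X).
  by congr pair; rewrite /= scaler0 addr0.
have rT z : rn (T z) = rn z by rewrite /rn nT.
exists U.
  split=> [a x y|x|]; first by rewrite /U addl linT.
    by apply: eq_normr_rn; rewrite -(rn_dsum_l N q1) -TU rT rn_dsum_l.
  apply/seteqP; split => // x _; exists (S (x, 0)).1 => //.
  by rewrite /U -SU ST.
exists W.
  split=> [a x y|y|]; first by rewrite /W addr linT.
    by apply: eq_normr_rn; rewrite -(rn_dsum_r N p1) -TW rT rn_dsum_r.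
  apply/seteqP; split => // y _; exists (S (0, y)).2 => //.
  by rewrite /W -SW ST.
apply/funext => -[x y] /=.
have -> : ((x, y) : X) = ((x, 0) : X) + ((0, y) : X).
  by congr pair; rewrite /= ?addr0 ?add0r.
by rewrite (lin_add linT) TU TW; congr pair; rewrite /= ?addr0 ?add0r.
Qed.

Lemma isom_stratum n alpha gamma (T : X -> X) (V : set X) : Isom X T ->
  stratum n alpha gamma V -> stratum n alpha gamma (T @` V).
Proof.
move=> isoT; have [S [isoS TS ST]] := isom_inverse isoT; have [linT _ _] := isoT.
have injT := can_inj TS.
have imT (D : pred idx) : D =1 inA \/ D =1 inB ->
    T @` V `&` zero_on D = T @` (V `&` zero_on D).
  move=> DE; apply/seteqP; split => [_ [[x Vx <-] /(isom_zero_on isoS DE)]|_ [x [Vx x0] <-]].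
    by rewrite TS => x0; exists x.
  by split; [exists x|exact: isom_zero_on].
rewrite /stratum lpA_zero_on lqB_zero_on => -[Vn Va Vg]; split.
- exact: has_dim_image.
- by rewrite imT; [exact: has_dim_image|right].
- by rewrite imT; [exact: has_dim_image|left].
Qed.

(** The Pluecker coordinate of T v at f(I) is that of v at I times a product of nonzero c_i. As f
    preserves sides but not the order, the tuple is sorted again. *)
Lemma isom_prof n (T : X -> X) (V : set X) : Isom X T -> prof n V `<=` prof n (T @` V).
Proof.
move=> isoT [a b] [/= abn [v vV [I [_ Ia Ib vI]]]]; split => //.
have [S [_ TS _]] := isom_inverse isoT; have [linT _ _] := isoT.
exists (T \o v); first exact: is_basis_image (can_inj TS) vV.
have [f [c [_ sf c0 Tf]]] := isom_monomial pq p2 q2 isoT.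
have [|J [sJ IJ TvJ]] := plucker_sort (v := T \o v) (I := map_tuple f I).
  have -> : plucker (T \o v) (map_tuple f I) =
      plucker v I * \prod_(s < n) c (tnth I s).
    rewrite /plucker -[X in _ * X](_ : \det (diag_mx (\row_s c (tnth I s))) = _).
      rewrite -det_mulmx; congr (\det _); apply/matrixP => r s.
      by rewrite mul_mx_diag !mxE tnth_map Tf mulrC.
    by rewrite det_diag; apply: eq_bigr => s _; rewrite mxE.
  by rewrite mulf_neq0//; apply/prodf_neq0.
exists J; split => //.
- rewrite -(permP IJ) /= count_map -Ia; apply: eq_count => i /=; exact: sf.
- rewrite -(permP IJ) /= count_map -Ib; apply: eq_count => i /=; by rewrite /inB sf.
Qed.

(** Both dimensions are n minus the largest number of D-indices in a nonzero Pluecker coordinate,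
    which can be read off from the profile. *)
Lemma prof_dim n (V V' : set X) (D : pred idx) k : (D =1 inA \/ D =1 inB) ->
  Gr n V -> Gr n V' -> prof n V = prof n V' ->
  has_dim (V `&` zero_on D) k -> has_dim (V' `&` zero_on D) k.
Proof.
move=> DE [v vV] [v' v'V'] VV'.
have [m [mn Vm [I vI Im] maxm]] := profile_max D vV.
have [m' [m'n V'm' [I' vI' Im'] maxm']] := profile_max D v'V'.
have count_prof (W : set X) (w : 'I_n -> X) : is_basis w W ->
    forall J : n.-tuple idx, plucker w J != 0 -> prof n W (count inA J, count inB J).
  move=> wW J wJ; split => /=; first by rewrite count_predC size_tuple.
  have [J' [sJ' JJ' wJ']] := plucker_sort wJ; exists w => //; exists J'.
  by split => //; rewrite -(permP JJ').
have transfer (W W' : set X) (w w' : 'I_n -> X) : is_basis w W -> is_basis w' W' ->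
    prof n W = prof n W' -> forall J : n.-tuple idx, plucker w J != 0 ->
    exists2 J' : n.-tuple idx, plucker w' J' != 0 & count D J' = count D J.
  move=> wW w'W' WW' J /(count_prof _ _ wW); rewrite WW' => -[_ [u uW' [J' [_ cA cB uJ']]]].
  exists J'; first exact: plucker_neq0 uW' w'W' uJ'.
  by case: DE => DE; rewrite !(eq_count DE).
have mm' : m = m'.
  apply/eqP; rewrite eqn_leq; apply/andP; split.
    by have [J' /maxm' + cJ'] := transfer _ _ _ _ vV v'V' VV' I vI; rewrite cJ' Im.
  by have [J /maxm + cJ] := transfer _ _ _ _ v'V' vV (esym VV') I' vI'; rewrite cJ Im'.
by move=> Vk; rewrite (has_dim_uniq Vk Vm) mm'.
Qed.

End isometry_group.

Theorem proposition6p5 (R : realType) (p q : R) (p1 : 1 <= p) (q1 : 1 <= q)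
    (pq : p != q) (p2 : p != 2) (q2 : q != 2) (n : nat) (n1 : (1 <= n)%N)
    (N : sum_norm R) :
  let X : normedModType R[i] := dsum N (lp p1) (lp q1) in
  [/\ Isom X = [set (fun z : X => (U z.1, W z.2)) |
                   U in Isom (lp p1) & W in Isom (lp q1)],
      forall (alpha gamma : nat) (T : X -> X), Isom X T ->
        [set T @` V | V in stratum n alpha gamma] =
        stratum n alpha gamma :> set (set X),
      forall (T : X -> X) (V : set X), Isom X T -> Gr n V ->
        prof n (T @` V) = prof n V,
      forall V V' : set X, Gr n V -> Gr n V' -> prof n V = prof n V' ->
        forall alpha gamma : nat,
          stratum n alpha gamma V <-> stratum n alpha gamma V' &
      exists2 V0 : set X, Gr n V0 & Gr n = [set g @` V0 | g in GLop X]].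
Proof.
move=> X.
have imTS (T S : X -> X) (V : set X) : cancel S T -> T @` (S @` V) = V.
  move=> ST; rewrite image_comp (_ : T \o S = id) ?image_id//.
  by apply/funext => x /=; rewrite ST.
split.
- exact: isom_dsum.
- move=> alpha gamma T isoT; have [S [isoS TS ST]] := isom_inverse isoT.
  apply/seteqP; split => [_ [V Vs <-]|V Vs]; first exact: isom_stratum.
  by exists (S @` V); [exact: isom_stratum|exact: imTS].
- move=> T V isoT _; have [S [isoS TS ST]] := isom_inverse isoT.
  apply/seteqP; split; last exact: isom_prof.
  (* The inclusion for S, applied to the image of V under T. *)
  by rewrite -[X in _ `<=` prof n X](imTS S T V TS); exact: isom_prof.
- move=> V V' Vn V'n VV' alpha gamma; rewrite /stratum lpA_zero_on lqB_zero_on.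
  split=> -[_ Va Vg]; split=> //.
  + exact: (prof_dim (or_intror (frefl _)) Vn V'n VV' Va).
  + exact: (prof_dim (or_introl (frefl _)) Vn V'n VV' Vg).
  + exact: (prof_dim (or_intror (frefl _)) V'n Vn (esym VV') Va).
  + exact: (prof_dim (or_introl (frefl _)) V'n Vn (esym VV') Vg).
- exact: Gr_orbit.
Qed.
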